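(* Let ${\bf X}_1,{\bf X}_2$ be statistically independent $d$-dimensional real random vectors with characteristic functions $f_i({\bf t})=\mathbb E[e^{j{\bf t}^T{\bf X}_i}]$, and suppose ${\bf X}_1+{\bf X}_2$ and ${\bf X}_1-{\bf X}_2$ are $\epsilon$-dependent. Then for all $\epsilon$ below some positive threshold there exist mean vectors $\widehat{\bf m}_1,\widehat{\bf m}_2\in\mathbb R^d$ and a common symmetric positive semi-definite matrix $\widehat{\bf Q}$ such that, with $\Phi_i({\bf t})=e^{{\bf t}^T(j\widehat{\bf m}_i-\frac12\widehat{\bf Q}{\bf t})}$, $$|f_i({\bf t})-\Phi_i({\bf t})|\le\tilde C\,\epsilon\quad\text{for all }{\bf t}\in\mathbb R^d,\ i=1,2,$$ for a constant $\tilde C$ independent of $\epsilon$ and ${\bf t}$. In particular, if $\epsilon=0$, then ${\bf X}_1$ and ${\bf X}_2$ are Gaussian with the same covariance matrix.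
   Context: $j=\sqrt{-1}$; $\|{\bf x}\|=\sum_i|x_i|$. For random vectors ${\bf U}_1,{\bf U}_2$ with joint characteristic function $f_{{\bf U}_1,{\bf U}_2}({\bf t}_1,{\bf t}_2)=\mathbb E[e^{j{\bf t}_1^T{\bf U}_1+j{\bf t}_2^T{\bf U}_2}]$ and marginal characteristic functions $f_{{\bf U}_1},f_{{\bf U}_2}$: they are $(\epsilon,T)$-dependent if $\sup_{\|{\bf t}_1\|\le T,\|{\bf t}_2\|\le T}|f_{{\bf U}_1,{\bf U}_2}({\bf t}_1,{\bf t}_2)-f_{{\bf U}_1}({\bf t}_1)f_{{\bf U}_2}({\bf t}_2)|\le\epsilon$, and $\epsilon$-dependent if they are $(\epsilon,T)$-dependent for every $T\ge0$ (i.e. the supremum over all ${\bf t}_1,{\bf t}_2$ is at most $\epsilon$). *)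

(* Defs.v *)
From HB Require Import structures.
From mathcomp Require Import all_boot all_order all_algebra.
From mathcomp Require Import all_classical all_reals all_analysis.
From mathcomp Require Import complex.
Set Implicit Arguments. Unset Strict Implicit. Unset Printing Implicit Defensive.
Import Order.TTheory GRing.Theory Num.Theory.
Local Open Scope ring_scope.
Local Open Scope classical_set_scope.

Definition cmod {R : realType} (z : complex R) : R := ComplexField.Normc.normc z.

Section Defs.
Context {dT : measure_display} {T : measurableType dT} {R : realType}.

Definition dotv (d : nat) (t v : 'rV[R]_d) : R := \sum_(i < d) t 0 i * v 0 i.

Definition norm1 (d : nat) (t : 'rV[R]_d) : R := \sum_(i < d) `|t 0 i|.

Definition random_vector (d : nat) (X : T -> 'rV[R]_d) :=
  forall i : 'I_d, measurable_fun setT (fun x => X x 0 i).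

Definition sigma_of (d : nat) (X : T -> 'rV[R]_d) : set (set T) :=
  <<s [set E | exists (i : 'I_d) (A : set R),
                 measurable A /\ E = (fun x => X x 0 i) @^-1` A] >>.

Definition independent (P : probability T R) (d : nat) (X1 X2 : T -> 'rV[R]_d) :=
  forall E F, sigma_of X1 E -> sigma_of X2 F -> P (E `&` F) = (P E * P F)%E.

(* expectation of a real function (used for bounded measurable functions) *)
Definition expectR (P : probability T R) (g : T -> R) : R :=
  fine (\int[P]_x (g x)%:E).

(* E[e^{j g}] = E[cos g] + j E[sin g] *)
Definition cf_phase (P : probability T R) (g : T -> R) : complex R :=
  Complex (expectR P (fun x => cos (g x))) (expectR P (fun x => sin (g x))).

Definition charfun (P : probability T R) (d : nat) (X : T -> 'rV[R]_d)
  (t : 'rV[R]_d) : complex R := cf_phase P (fun x => dotv t (X x)).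

Definition joint_charfun (P : probability T R) (d : nat) (U1 U2 : T -> 'rV[R]_d)
  (t1 t2 : 'rV[R]_d) : complex R :=
  cf_phase P (fun x => dotv t1 (U1 x) + dotv t2 (U2 x)).

Definition eps_T_dependent (P : probability T R) (d : nat) (U1 U2 : T -> 'rV[R]_d)
  (eps Tb : R) :=
  forall t1 t2 : 'rV[R]_d, norm1 t1 <= Tb -> norm1 t2 <= Tb ->
    cmod (joint_charfun P U1 U2 t1 t2 - charfun P U1 t1 * charfun P U2 t2) <= eps.

Definition eps_dependent (P : probability T R) (d : nat) (U1 U2 : T -> 'rV[R]_d)
  (eps : R) :=
  forall Tb : R, 0 <= Tb -> eps_T_dependent P U1 U2 eps Tb.

End Defs.

Definition sym_psd {R : realType} (d : nat) (Q : 'M[R]_d) :=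
  Q^T = Q /\ forall v : 'rV[R]_d, 0 <= (v *m Q *m v^T) 0 0.

(* Phi(t) = exp(t^T (j m - 1/2 Q t)) = exp(-1/2 t^T Q t) (cos(t^T m) + j sin(t^T m)) *)
Definition gauss_cf {R : realType} (d : nat) (m : 'rV[R]_d) (Q : 'M[R]_d)
  (t : 'rV[R]_d) : complex R :=
  Complex (expR (- (1/2) * (t *m Q *m t^T) 0 0)) 0 *
  Complex (cos (dotv t m)) (sin (dotv t m)).

(* Main.v *)
Require Import Defs.
From HB Require Import structures.
From mathcomp Require Import all_boot all_order all_algebra perm.
From mathcomp Require Import all_classical all_reals all_analysis.
From mathcomp Require Import measurable_realfun complex.
From mathcomp Require Import ring lra.
Set Implicit Arguments. Unset Strict Implicit. Unset Printing Implicit Defensive.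
Import Order.TTheory GRing.Theory Num.Theory.
Import numFieldNormedType.Exports.
Local Open Scope ring_scope.
Local Open Scope classical_set_scope.

(** Write f, g for the characteristic functions of X1, X2. Independence turns the
    hypothesis into the approximate functional equation
    |f(x+y) g(x-y) - f(x) g(x) f(y) g(-y)| <= eps for all x, y. On the region N
    where |f|, |g| stay above 1/32 along the segment from 0, - ln |f| is an
    approximate quadratic form and f / |f| an approximate character. A basis of
    nearly maximal determinant among the vectors of N in a box makes this part of
    N comparable to a cube, with constants depending on d only; on a cube,
    approximately additive bounded functions are within O(eps) of linear ones,
    because doubling contracts the defect. Letting the box grow gives a Gaussian
    approximation on all of N. Outside N the functions are small, and there
    f(2x) ~ f(x)^2 |g(x)|^2 makes doubling a contraction of the error, so the
    O(eps) bound extends to the whole space. *)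

(** * Unit complex numbers and arguments *)

Section Trig.
Context {R : realType}.
Implicit Types (a b s : R) (z w : complex R).

(** The constants may depend on [d] only, although the two laws carry no scale: |f| may decay
    arbitrarily fast in one direction and not at all in another. The functional equation is
    invariant under linear substitutions, so a basis adapted to the near region absorbs this
    anisotropy. That region is only star-shaped, which is why the basis is selected by determinants;
    it may be unbounded, which is why boxes come in. The Gaussian fits found in different boxes need
    not agree, but all are close to 1 on one fixed cube, so their parameters stay bounded and have a
    limit. Logarithms and arguments need lower bounds on |f| and |g|, and each division costs a
    fixed power of them; this confines the additive method to the near region. The thresholds 1/32
    and 1/2 are matched: where the Gaussian modulus is at least 1/2 along a segment, doubling stays
    in the near region; where it is at most 1/2, the fourfold product in the equation shrinks
    errors. Continuity of f and g at 0 enters only qualitatively, to start the lift of the phase and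
    to supply some cube inside the near region. *)

Definition cis a : complex R := Complex (cos a) (sin a).

Lemma cmod_ge0 z : 0 <= cmod z.
Proof. by case: z => x y; rewrite /cmod /= sqrtr_ge0. Qed.

Lemma cmod_def (x y : R) : cmod (Complex x y) = Num.sqrt (x ^+ 2 + y ^+ 2).
Proof. by []. Qed.

Lemma cmodM z w : cmod (z * w) = cmod z * cmod w.
Proof. exact: ComplexField.Normc.normcM. Qed.

Lemma cmodD z w : cmod (z + w) <= cmod z + cmod w.
Proof. exact: le_normcD. Qed.

Lemma cmodN z : cmod (- z) = cmod z.
Proof. exact: normcN. Qed.

Lemma cmod0 : cmod (0 : complex R) = 0.
Proof. exact: ComplexField.Normc.normc0. Qed.

Lemma cmod1 : cmod (1 : complex R) = 1.
Proof. exact: ComplexField.Normc.normc1. Qed.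

Lemma cmod_eq0 z : cmod z = 0 -> z = 0.
Proof. exact: ComplexField.Normc.eq0_normc. Qed.

Lemma cmodB z w : cmod (z - w) = cmod (w - z).
Proof. by rewrite -cmodN opprB. Qed.

Lemma cmod_dist_le z1 z2 z3 : cmod (z1 - z3) <= cmod (z1 - z2) + cmod (z2 - z3).
Proof. by have := cmodD (z1 - z2) (z2 - z3); rewrite addrA subrK. Qed.

Lemma cmod_lerB z w : cmod z - cmod w <= cmod (z - w).
Proof. by rewrite lerBlDr; have := cmodD (z - w) w; rewrite subrK. Qed.

Lemma cmod_dist_norm z w : `|cmod z - cmod w| <= cmod (z - w).
Proof.
rewrite ler_norml; apply/andP; split; last exact: cmod_lerB.
by rewrite lerNl opprB cmodB; exact: cmod_lerB.
Qed.

Lemma cmod_real (x : R) : cmod (Complex x 0) = `|x|.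
Proof. by rewrite cmod_def expr0n addr0 sqrtr_sqr. Qed.

Lemma cmod_conj (x y : R) : cmod (Complex x (- y)) = cmod (Complex x y).
Proof. by rewrite !cmod_def sqrrN. Qed.

Lemma ge_cmod_Re (x y : R) : `|x| <= cmod (Complex x y).
Proof. by rewrite cmod_def -sqrtr_sqr ler_wsqrtr // lerDl sqr_ge0. Qed.

Lemma ge_cmod_Im (x y : R) : `|y| <= cmod (Complex x y).
Proof. by rewrite cmod_def -sqrtr_sqr ler_wsqrtr // lerDr sqr_ge0. Qed.

Lemma cis0 : cis 0 = 1.
Proof. by rewrite /cis cos0 sin0. Qed.

Lemma cisD a b : cis (a + b) = cis a * cis b.
Proof.
by rewrite /cis cosD sinD; congr Complex; rewrite addrC.
Qed.

Lemma cmod_cis a : cmod (cis a) = 1.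
Proof. by rewrite /cis cmod_def cos2Dsin2 sqrtr1. Qed.

Lemma cmod_cisB a b : cmod (cis a - cis b) = 2 * `|sin ((a - b) / 2)|.
Proof.
have -> : cis a - cis b = cis b * (cis (a - b) - 1).
  by rewrite mulrBr mulr1 -cisD [b + _]addrC subrK.
rewrite cmodM cmod_cis mul1r; set c := a - b.
have -> : cis c - 1 = Complex (cos c - 1) (sin c).
  by rewrite /cis; congr Complex; rewrite /= subr0.
rewrite cmod_def.
have hc : c = (c / 2) *+ 2 by rewrite -mulr_natr divfK.
have h1 : cos c = 1 - 2 * sin (c / 2) ^+ 2.
  rewrite {1}hc cos_mulr2n cos2sin2; ring.
have -> : (cos c - 1) ^+ 2 + sin c ^+ 2 = (2 * `|sin (c / 2)|) ^+ 2.
  rewrite exprMn real_normK ?num_real // sin2cos2 h1; ring.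
by rewrite sqrtr_sqr ger0_norm // mulr_ge0.
Qed.

Lemma sin_MVT b : 0 < b -> exists2 c, 0 < c < b & sin b = cos c * b.
Proof.
move=> b0; have [|c] := @MVT R sin cos 0 b b0 (fun x _ => is_derive_sin x).
  by apply: continuous_subspaceT => x; exact: continuous_sin.
by rewrite in_itv /= sin0 !subr0 => cb ->; exists c.
Qed.

Lemma sin_le_norm a : `|sin a| <= `|a|.
Proof.
suff H b : 0 <= b -> `|sin b| <= b.
  case: (leP 0 a) => a0; first by rewrite [leRHS]ger0_norm ?H.
  by rewrite -normrN -sinN -[leRHS]normrN [leRHS]ger0_norm ?H; lra.
move=> b0.
have [->|bn0] := eqVneq b 0; first by rewrite sin0 normr0.
have bp : 0 < b by rewrite lt_neqAle eq_sym bn0.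
have [c _ ->] := sin_MVT bp; rewrite normrM (gtr0_norm bp).
by rewrite ler_piMl ?cos_max.
Qed.

Lemma cmod_cisB_le a b : cmod (cis a - cis b) <= `|a - b|.
Proof.
rewrite cmod_cisB; have := sin_le_norm ((a - b) / 2).
rewrite normrM (ger0_norm (_ : 0 <= 2^-1 :> R)) ?invr_ge0 //; lra.
Qed.

Lemma cos_ge_half a : `|a| <= 1 -> 1 / 2 <= cos a.
Proof.
move=> ha.
have hc : a = (a / 2) *+ 2 by rewrite -mulr_natr divfK.
have h1 : cos a = 1 - 2 * sin (a / 2) ^+ 2.
  rewrite {1}hc cos_mulr2n cos2sin2; ring.
have h2 := sin_le_norm (a / 2).
rewrite normrM (ger0_norm (_ : 0 <= 2^-1 :> R)) ?invr_ge0 // in h2.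
have h3 : `|sin (a / 2)| ^+ 2 <= (1/2) ^+ 2.
  by rewrite ler_sqr ?nnegrE //; lra.
rewrite real_normK ?num_real // in h3.
rewrite h1; lra.
Qed.

Lemma norm_le_sin a : `|a| <= 1 -> `|a| <= 2 * `|sin a|.
Proof.
suff H b : 0 <= b <= 1 -> b <= 2 * `|sin b|.
  case: (leP 0 a) => a0; first by rewrite ger0_norm // => ?; apply: H; rewrite a0.
  rewrite ltr0_norm // => a1; rewrite -[`|sin a|]normrN -sinN; apply: H; lra.
case/andP=> b0 b1.
have [->|bn0] := eqVneq b 0; first by rewrite mulr_ge0.
have bp : 0 < b by rewrite lt_neqAle eq_sym bn0.
have [c /andP[c0 cb] ->] := sin_MVT bp.
have hc : 1 / 2 <= cos c by apply: cos_ge_half; rewrite ger0_norm; lra.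
rewrite ger0_norm ?mulr_ge0 //; try lra.
nra.
Qed.

(** Partial converse of [cmod_cisB_le]. The interval [-2, 2] contains no nonzero multiple of 2 pi,
    so closeness of [cis a] to 1 controls [a] itself; this is what excludes jumps by 2 pi. *)
Lemma norm_le_cmod_cis a : `|a| <= 2 -> `|a| <= 2 * cmod (cis a - 1).
Proof.
move=> ha; rewrite -cis0 cmod_cisB subr0.
have : `|a / 2| <= 2 * `|sin (a / 2)|.
  apply: norm_le_sin; rewrite normrM (ger0_norm (_ : 0 <= 2^-1 :> R)) ?invr_ge0 //; lra.
rewrite normrM (ger0_norm (_ : 0 <= 2^-1 :> R)) ?invr_ge0 //; lra.
Qed.

(** For [k <= 1] the cosine is nonnegative, so [asin (sin a)] represents [a] modulo 2 pi; it lies in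
    [-2, 2], where [norm_le_cmod_cis] applies. *)
Lemma small_arg_exists a k : cmod (cis a - 1) <= k -> k <= 1 ->
  exists2 s, `|s| <= 2 * k & cis s = cis a.
Proof.
move=> hk k1.
have hre : `|cos a - 1| <= 1.
  apply: le_trans k1; apply: le_trans hk.
  have -> : cis a - 1 = Complex (cos a - 1) (sin a).
    by rewrite /cis; congr Complex; rewrite /= subr0.
  exact: ge_cmod_Re.
have ca : 0 <= cos a by move: hre; rewrite ler_norml => /andP[]; lra.
have sr : -1 <= sin a <= 1 by rewrite sin_geN1 sin_le1.
have e : cis (asin (sin a)) = cis a.
  rewrite /cis cos_asin // asinK // -cos2sin2 sqrtr_sqr ger0_norm //.
exists (asin (sin a)) => //.
have h2 : `|asin (sin a)| <= 2.
  have := asin_geNpi2 sr; have := asin_lepi2 sr; have := @pihalf_lt2 R.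
  by rewrite ler_norml => ? ? ?; apply/andP; split; lra.
by apply: le_trans (norm_le_cmod_cis h2) _; rewrite e; lra.
Qed.

Lemma polar_exists z : exists a, z = Complex (cmod z) 0 * cis a.
Proof.
have [->|z0] := eqVneq z 0.
  by exists 0; rewrite cmod0 (_ : Complex 0 0 = 0) // mul0r.
have cz : 0 < cmod z.
  rewrite lt_neqAle cmod_ge0 andbT eq_sym; apply: contra z0 => /eqP h.
  by apply/eqP/cmod_eq0.
case: z z0 cz => x y z0 cz; set c := cmod _ in cz *.
have hxc : `|x| <= c by exact: ge_cmod_Re.
have hr : -1 <= x / c <= 1.
  by rewrite -ler_norml normrM normfV (gtr0_norm cz) ler_pdivrMr // mul1r.
have hc : c ^+ 2 = x ^+ 2 + y ^+ 2.
  by rewrite /c cmod_def sqr_sqrtr // addr_ge0 // sqr_ge0.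
have cn : c != 0 by rewrite gt_eqF.
have hs : c * Num.sqrt (1 - (x / c) ^+ 2) = `|y|.
  rewrite -{1}(gtr0_norm cz) -sqrtr_sqr -sqrtrM ?sqr_ge0 // -sqrtr_sqr.
  congr Num.sqrt; have -> : y ^+ 2 = c ^+ 2 - x ^+ 2 by rewrite hc; ring.
  by field.
have hx : c * (x / c) = x by rewrite mulrCA divff // mulr1.
case: (leP 0 y) => y0.
  exists (acos (x / c)); rewrite /cis acosK // sin_acos //.
  apply/eqP; rewrite eq_complex /=; apply/andP; split; apply/eqP.
    by rewrite mul0r subr0 hx.
  by rewrite mul0r addr0 hs ger0_norm.
exists (- acos (x / c)); rewrite /cis cosN sinN acosK // sin_acos //.
apply/eqP; rewrite eq_complex /=; apply/andP; split; apply/eqP.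
  by rewrite mul0r subr0 hx.
by rewrite mul0r addr0 mulrN hs ltr0_norm // opprK.
Qed.

End Trig.

(** * Approximately additive functions *)

Section ApproxAdditive.
Context {R : realType}.

Lemma le_of_le_addexp (x y K : R) :
  (forall n : nat, x <= y + K / 2 ^+ n) -> x <= y.
Proof.
move=> H; apply/ler_addgt0Pr => e e0.
have K0 : 0 <= `|K| by [].
pose n := Num.truncn (`|K| / e).
have hn : `|K| / e < n.+1%:R by rewrite truncnS_gt ?divr_ge0 // ltW.
apply: le_trans (H n.+1) _; rewrite lerD2l.
apply: le_trans (_ : `|K| / 2 ^+ n.+1 <= e).
  by rewrite ler_wpM2r ?ler_norm // invr_ge0 exprn_ge0.
rewrite ler_pdivrMr ?exprn_gt0 //; rewrite ltr_pdivrMr // in hn.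
apply: (le_trans (ltW hn)); rewrite mulrC ler_wpM2l ?(ltW e0) //.
by rewrite -natrX ler_nat ltnW // ltn_expl.
Qed.

(* Doubling contracts the defect g s = h s - s h(1) towards [0, 1], since
   g(2s) is close to both 2 g(s) and g(2s - 1); hence the bound on g does not
   depend on the bound M on h. *)
Lemma approx_additive_line (h : R -> R) (dl M : R) :
  (forall s t, `|s| <= 2 -> `|t| <= 2 -> `|s + t| <= 2 ->
     `|h (s + t) - h s - h t| <= dl) ->
  (forall s, `|s| <= 2 -> `|h s| <= M) ->
  forall s, `|s| <= 2 -> `|h s - s * h 1| <= 5 * dl.
Proof.
move=> hadd hb; pose g s := h s - s * h 1.
have gadd s t : `|s| <= 2 -> `|t| <= 2 -> `|s + t| <= 2 ->
    `|g (s + t) - g s - g t| <= dl.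
  move=> s2 t2 st2; have := hadd s t s2 t2 st2; congr (`|_| <= _); rewrite /g; ring.
have g1 : g 1 = 0 by rewrite /g mul1r subrr.
have n0 : `|0 : R| <= 2 by rewrite normr0.
have n1 : `|1 : R| <= 2 by rewrite normr1; lra.
have dl0 : 0 <= dl by apply: le_trans (hadd 0 0 n0 n0 _); rewrite ?addr0.
have g0 : `|g 0| <= dl.
  have := gadd 0 0 n0 n0; rewrite addr0 subrr sub0r normrN; exact.
have unit_bound : forall n s, 0 <= s <= 1 -> `|g s| <= 2 * dl + 2 * M / 2 ^+ n.
  elim=> [|n IH] s /andP[s0 s1].
    rewrite expr0 divr1; have hs := hb s; have h1 := hb 1 n1.
    have : `|g s| <= `|h s| + `|s * h 1| by rewrite /g ler_normB.
    have : `|s| <= 2 by rewrite ger0_norm; lra.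
    move=> /hs; rewrite normrM (ger0_norm s0) => h2 h3.
    have : s * `|h 1| <= 1 * M by apply: ler_pM.
    by lra.
  have s2 : `|s| <= 2 by rewrite ger0_norm; lra.
  have ss2 : `|s + s| <= 2 by rewrite ger0_norm; lra.
  have e : 2 * M / 2 ^+ n.+1 = (2 * M / 2 ^+ n) / 2.
    by rewrite exprSr invfM mulrA.
  have := gadd s s s2 s2 ss2; rewrite e; set k := 2 * M / _ in IH *.
  case: (leP s (1 / 2)) => hs.
    have : `|g (s + s)| <= 2 * dl + k by apply: IH; lra.
    by rewrite !ler_norml => /andP[? ?] /andP[? ?]; apply/andP; split; lra.
  have IH1 : `|g (s + s - 1)| <= 2 * dl + k by apply: IH; lra.
  have := gadd (s + s - 1) 1; rewrite subrK g1 subr0 => /(_ _ n1 ss2) h1 h2.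
  have {}h1 : `|g (s + s) - g (s + s - 1)| <= dl.
    by apply: h1; rewrite ger0_norm; lra.
  move: IH1 h1 h2; rewrite !ler_norml => /andP[? ?] /andP[? ?] /andP[? ?].
  by apply/andP; split; lra.
have g01 s : 0 <= s <= 1 -> `|g s| <= 2 * dl.
  by move=> hs; apply: (@le_of_le_addexp _ _ (2 * M)) => n; exact: unit_bound.
have g02 s : 0 <= s <= 2 -> `|g s| <= 3 * dl.
  case/andP=> s0 s2; case: (leP s 1) => s1.
    by have : `|g s| <= 2 * dl; [apply: g01; lra | lra].
  have h1 : `|g (s - 1)| <= 2 * dl by apply: g01; lra.
  have := gadd (s - 1) 1; rewrite subrK g1 subr0 => /(_ _ n1 _) h2.
  have {h2} : `|g s - g (s - 1)| <= dl by apply: h2; rewrite ger0_norm; lra.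
  move: h1; rewrite !ler_norml => /andP[? ?] /andP[? ?].
  by apply/andP; split; lra.
move=> s; rewrite -/(g s) ler_norml => /andP[s1 s2].
case: (leP 0 s) => s0.
  by have : `|g s| <= 3 * dl; [apply: g02; lra | lra].
have h1 : `|g (- s)| <= 3 * dl by apply: g02; lra.
have := gadd s (- s); rewrite subrr => h2.
have {}h2 : `|g 0 - g s - g (- s)| <= dl.
  by apply: h2 => //; rewrite ler_norml; apply/andP; split; lra.
move: h1 h2 g0; rewrite !ler_norml => /andP[? ?] /andP[? ?] /andP[? ?].
by apply/andP; split; lra.
Qed.

Definition cube (d : nat) (l : R) (x : 'rV[R]_d) := forall i, `|x 0 i| <= l.

Section Cube.
Context {d : nat}.
Implicit Types x y : 'rV[R]_d.

Lemma cube_le l l' x : l <= l' -> cube l x -> cube l' x.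
Proof. by move=> ll' xl i; exact: le_trans (xl i) ll'. Qed.

Lemma cubeD l l' x y : cube l x -> cube l' y -> cube (l + l') (x + y).
Proof. by move=> xl yl i; rewrite mxE (le_trans (ler_normD _ _)) // lerD. Qed.

Lemma cubeN l x : cube l x -> cube l (- x).
Proof. by move=> xl i; rewrite mxE normrN. Qed.

Lemma cubeB l l' x y : cube l x -> cube l' y -> cube (l + l') (x - y).
Proof. by move=> xl /cubeN; exact: cubeD. Qed.

Lemma cubeZ l a x : cube l x -> cube (`|a| * l) (a *: x).
Proof. by move=> xl i; rewrite mxE normrM ler_wpM2l. Qed.

Lemma cube0 l : 0 <= l -> cube l (0 : 'rV[R]_d).
Proof. by move=> l0 i; rewrite mxE normr0. Qed.

Lemma cube_delta i : cube 1 (delta_mx 0 i : 'rV[R]_d).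
Proof. by move=> j; rewrite mxE eqxx /=; case: (j == i); rewrite /= ?normr1 ?normr0. Qed.

Lemma row_partial_sum (c : 'rV[R]_d) (r : seq 'I_d) j : uniq r ->
  (\sum_(i <- r) c 0 i *: (delta_mx 0 i : 'rV[R]_d)) 0 j =
  if j \in r then c 0 j else 0.
Proof.
elim: r => [|i r IH] /=; first by rewrite big_nil mxE.
case/andP=> ir ur; rewrite big_cons !mxE IH // in_cons eqxx /=.
case: eqVneq => [->|ji]; last by rewrite mulr0 add0r.
by rewrite (negbTE ir) mulr1 addr0.
Qed.

(** A partial sum is [c] with some coordinates replaced by 0, so [c] can be built one coordinate at
    a time inside the cube. *)
Lemma cube_partial_sum l (c : 'rV[R]_d) (r : seq 'I_d) : 0 <= l -> uniq r ->
  cube l c -> cube l (\sum_(i <- r) c 0 i *: (delta_mx 0 i : 'rV[R]_d)).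
Proof.
move=> l0 ur cl j; rewrite row_partial_sum //.
by case: ifP => _; rewrite ?normr0.
Qed.

(** Each coordinate costs [5 * dl] along its axis and [dl] for the addition; the last [dl] is |h 0|,
    from the empty sum. *)
Lemma approx_additive_cube (h : 'rV[R]_d -> R) (dl M : R) :
  (forall x y, cube 2 x -> cube 2 y -> cube 2 (x + y) ->
     `|h (x + y) - h x - h y| <= dl) ->
  (forall x, cube 2 x -> `|h x| <= M) ->
  forall c, cube 2 c ->
    `|h c - \sum_i c 0 i * h (delta_mx 0 i)| <= (6 * d%:R + 1) * dl.
Proof.
move=> hadd hb c c2.
have z2 : cube 2 (0 : 'rV[R]_d) by apply: cube0.
have dl0 : 0 <= dl.
  by apply: le_trans (hadd 0 0 z2 z2 _); rewrite ?addr0.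
have h0 : `|h 0| <= dl.
  by have := hadd 0 0 z2 z2; rewrite addr0 subrr sub0r normrN; exact.
have scale2 s i : `|s| <= 2 -> cube 2 (s *: (delta_mx 0 i : 'rV[R]_d)).
  move=> s2; apply: (@cube_le (`|s| * 1)); first by rewrite mulr1.
  exact/cubeZ/cube_delta.
have line i s : `|s| <= 2 ->
    `|h (s *: delta_mx 0 i) - s * h (delta_mx 0 i)| <= 5 * dl.
  move=> s2; have := @approx_additive_line (fun s => h (s *: delta_mx 0 i)) dl M.
  rewrite scale1r; apply=> // [u v u2 v2 uv2|u u2].
    rewrite scalerDl; apply: hadd; try exact: scale2.
    by rewrite -scalerDl; exact: scale2.
  by apply: hb; exact: scale2.
have H r : uniq r ->
    `|h (\sum_(i <- r) c 0 i *: delta_mx 0 i) - \sum_(i <- r) c 0 i * h (delta_mx 0 i)|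
      <= (6 * (size r)%:R + 1) * dl.
  elim: r => [|i r IH]; first by rewrite !big_nil subr0 mulr0 add0r mul1r.
  move=> uir; have /andP[ir ur] := uir.
  have h1 := cube_partial_sum (ler0n _ 2) uir c2; rewrite big_cons in h1.
  have := hadd _ _ (scale2 _ i (c2 i)) (cube_partial_sum (ler0n _ 2) ur c2) h1.
  have := line i _ (c2 i); have := IH ur.
  rewrite !big_cons /= -natr1; set a := h (_ + _); set b := h (\sum_(_ <- _) _).
  set n := (size r)%:R.
  rewrite !ler_norml => /andP[? ?] /andP[? ?] /andP[? ?].
  by apply/andP; split; lra.
have := H (index_enum 'I_d) (index_enum_uniq _).
have -> : size (index_enum 'I_d) = d.
  by rewrite [index_enum _]unlock -enumT size_enum_ord.
by rewrite -row_sum_delta.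
Qed.

End Cube.
End ApproxAdditive.

(** * Lipschitz bounds for the logarithm and the exponential *)

Section ExpLn.
Context {R : realType}.
Implicit Types a b q p : R.

Lemma norm_lnB_le a b k e : 0 < k -> k <= a -> k <= b -> `|a - b| <= e ->
  `|ln a - ln b| <= e / k.
Proof.
move=> k0 ka kb abe.
suff H u v : k <= u -> k <= v -> `|u - v| <= e -> ln u - ln v <= e / k.
  rewrite ler_norml lerNl opprB; apply/andP; split; apply: H => //.
  by rewrite distrC.
move=> ku kv uve; have u0 : 0 < u by lra.
have v0 : 0 < v by lra.
rewrite -ln_div ?posrE //.
have h1 : ln (u / v) <= u / v - 1.
  have uv0 : 0 < u / v by rewrite divr_gt0.
  by have := expR_ge1Dx (ln (u / v)); rewrite lnK ?posrE //; lra.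
apply: le_trans h1 _.
have -> : u / v - 1 = (u - v) / v by rewrite mulrBl divff // gt_eqF.
have e0 : 0 <= e by apply: le_trans uve.
apply: le_trans (_ : e / v <= _).
  by rewrite ler_wpM2r ?invr_ge0 ?(ltW v0) // (le_trans (ler_norm _)).
by rewrite ler_wpM2l // lef_pV2 ?posrE.
Qed.

(** In the application [q] is minus the logarithm of a modulus at most 1, whereas [p] is the value
    of a fitted quadratic form whose sign is still unknown; hence the estimate is centred at [q]. *)
Lemma norm_expRB_le q p n : 0 <= q -> `|q - p| <= n -> n <= 1 / 2 ->
  `|expR (- q) - expR (- p)| <= 2 * n.
Proof.
move=> q0 qp n1; set t := q - p in qp.
have -> : expR (- q) - expR (- p) = expR (- q) * (1 - expR t).
  by rewrite mulrBr mulr1 -expRD /t; congr (_ - expR _); ring.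
have eq1 : expR (- q) <= 1 by rewrite expR_le1; lra.
have eq0 := expR_gt0 (- q).
rewrite normrM (gtr0_norm eq0).
have ht : `|1 - expR t| <= 2 * n.
  have h1 := expR_ge1Dx t; have h2 := expR_ge1Dx (- t).
  have h3 : expR t * expR (- t) = 1 by rewrite -expRD subrr expR0.
  have h4 := expR_gt0 t.
  move: qp; rewrite !ler_norml => /andP[? ?].
  apply/andP; split; last by lra.
  have h5 : expR t * (1 - t) <= 1 by rewrite -h3 ler_wpM2l ?(ltW h4); lra.
  have h6 : expR t * (1 - n) <= 1.
    by apply: le_trans h5; rewrite ler_wpM2l ?(ltW h4) //; lra.
  have h7 : 1 <= (1 + 2 * n) * (1 - n) by nra.
  have : expR t <= 1 + 2 * n.
    have n0 : 0 < 1 - n by lra.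
    by rewrite -(ler_pM2r n0); lra.
  lra.
have : expR (- q) * `|1 - expR t| <= 1 * (2 * n).
  by apply: ler_pM => //; exact: ltW.
lra.
Qed.

End ExpLn.

(** * Approximate characters and quadratic forms on a cube *)

Section CirclePseudonorm.
Context {R : realType}.
Implicit Types a b s t : R.

(* [circ t] measures the distance of t to the multiples of 2 pi, so that phases
   can be compared without choosing an argument. *)
Definition circ t : R := cmod (cis t - 1).

Lemma circB a b : circ (a - b) = cmod (cis a - cis b).
Proof. by rewrite /circ -cis0 !cmod_cisB subr0. Qed.

Lemma circ_ge0 t : 0 <= circ t. Proof. exact: cmod_ge0. Qed.

Lemma circN t : circ (- t) = circ t.
Proof. by rewrite -[- t]sub0r circB cmodB -circB subr0. Qed.

Lemma circD s t : circ (s + t) <= circ s + circ t.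
Proof.
rewrite -[t in X in X <= _]opprK circB (le_trans (cmod_dist_le _ (cis 0) _)) //.
by rewrite -!circB subr0 sub0r opprK.
Qed.

Lemma circ_sub s t : circ (s - t) <= circ s + circ t.
Proof. by rewrite -[circ t]circN circD. Qed.

Lemma circ_le_norm t : circ t <= `|t|.
Proof. by rewrite /circ -cis0 -[leRHS]subr0 subr0 -[t in `|t|]subr0 cmod_cisB_le. Qed.

Lemma circ_eq_cis a b : cis a = cis b -> circ (a - b) = 0.
Proof. by move=> e; rewrite circB e subrr cmod0. Qed.

End CirclePseudonorm.

Section PhaseLinear.
Context {R : realType} {d : nat}.
Variables (phi gam : 'rV[R]_d -> R) (dl : R).
Hypothesis phase_eq : forall x y, cube 2 x -> cube 2 y ->
  cube 2 (x + y) -> cube 2 (x - y) ->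
  circ (phi (x + y) + gam (x - y) - phi x - gam x - phi y + gam y) <= dl.
Hypothesis gam0 : circ (gam 0) = 0.
Hypothesis gamN : forall z, cube 2 z -> circ (gam z + gam (- z)) = 0.
Hypothesis phi_small : exists2 l, 0 < l & forall x, cube l x -> circ (phi x) <= 1 / 8.
Hypothesis dl_small : 26 * dl <= 1.

Let cube_half l (x : 'rV[R]_d) : cube (2 * l) x -> cube l (2^-1 *: x).
Proof.
move=> /(cubeZ 2^-1); apply: cube_le.
by rewrite ger0_norm ?invr_ge0 // mulrA mulVf // mul1r.
Qed.

(** On the diagonal the two terms in [gam] cancel, except for [gam 0]. *)
Let phase_double x : cube 2 x -> circ (phi x - 2 * phi (2^-1 *: x)) <= dl.
Proof.
move=> x2; set y := 2^-1 *: x.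
have y1 : cube 1 y by apply: cube_half; rewrite mulr1.
have y2 : cube 2 y by apply: cube_le y1; lra.
have yy : y + y = x by rewrite -mulr2n -scaler_nat scalerA divff // scale1r.
have := @phase_eq y y y2 y2; rewrite yy subrr => /(_ x2 (cube0 _)) h.
have {h} := h (ler0n _ _).
have -> : phi x - 2 * phi y =
  (phi x + gam 0 - phi y - gam y - phi y + gam y) - gam 0 by ring.
have := circ_sub (phi x + gam 0 - phi y - gam y - phi y + gam y) (gam 0).
by rewrite gam0; lra.
Qed.

(** Exchanging the two arguments of [phase_eq] and adding cancels [gam], but yields additivity of
    [2 * phi] only, and halving is not possible modulo 2 pi. The equation is therefore used at half
    the points, and [phase_double] absorbs the factor 2: two uses of the equation and three
    doublings. *)
Let phase_add x y : cube 2 x -> cube 2 y -> cube 2 (x + y) ->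
  circ (phi (x + y) - phi x - phi y) <= 5 * dl.
Proof.
move=> x2 y2 xy2.
have x'1 : cube 1 (2^-1 *: x) by apply: cube_half; rewrite mulr1.
have y'1 : cube 1 (2^-1 *: y) by apply: cube_half; rewrite mulr1.
have xy'1 : cube 1 (2^-1 *: x + 2^-1 *: y).
  by rewrite -scalerDr; apply: cube_half; rewrite mulr1.
have c2 z : cube 1 z -> cube 2 (z : 'rV[R]_d) by apply: cube_le; lra.
have h1 := phase_double x2; have h2 := phase_double y2.
have h3 := phase_double xy2.
rewrite scalerDr in h3; set x' := 2^-1 *: x in x'1 xy'1 h1 h3 *.
set y' := 2^-1 *: y in y'1 xy'1 h2 h3 *.
have s2 : cube 2 (x' - y').
  by apply: cube_le (cubeB x'1 y'1); lra.
have s2' : cube 2 (y' - x').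
  by apply: cube_le (cubeB y'1 x'1); lra.
have h4 := phase_eq (c2 _ x'1) (c2 _ y'1) (c2 _ xy'1) s2.
have yx'1 : cube 2 (y' + x') by rewrite addrC; exact: c2.
have h5 := phase_eq (c2 _ y'1) (c2 _ x'1) yx'1 s2'.
have h6 := gamN s2; rewrite opprB in h6.
set p := phi (x + y) in h3 *; set p1 := phi (x' + y') in h3 h4.
rewrite (addrC y' x') -/p1 in h5.
have -> : p - phi x - phi y =
  (p - 2 * p1) - (phi x - 2 * phi x') - (phi y - 2 * phi y') +
  ((p1 + gam (x' - y') - phi x' - gam x' - phi y' + gam y') +
   (p1 + gam (y' - x') - phi y' - gam y' - phi x' + gam x')
   - (gam (x' - y') + gam (y' - x'))) by ring.
have := circD ((p - 2 * p1) - (phi x - 2 * phi x') - (phi y - 2 * phi y'))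
  ((p1 + gam (x' - y') - phi x' - gam x' - phi y' + gam y') +
   (p1 + gam (y' - x') - phi y' - gam y' - phi x' + gam x')
   - (gam (x' - y') + gam (y' - x'))).
have := circ_sub ((p - 2 * p1) - (phi x - 2 * phi x')) (phi y - 2 * phi y').
have := circ_sub (p - 2 * p1) (phi x - 2 * phi x').
have := circ_sub ((p1 + gam (x' - y') - phi x' - gam x' - phi y' + gam y') +
   (p1 + gam (y' - x') - phi y' - gam y' - phi x' + gam x'))
   (gam (x' - y') + gam (y' - x')).
have := circD (p1 + gam (x' - y') - phi x' - gam x' - phi y' + gam y')
   (p1 + gam (y' - x') - phi y' - gam y' - phi x' + gam x').
lra.
Qed.

(* A lift of the phase that is additive up to 10 dl exists near 0, where phi is
   close to 0 modulo 2 pi. Doubling the argument multiplies the additive defect by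
   at most 2 plus O(dl); as the defect is O(dl) modulo 2 pi and at most 2, it is
   again at most 10 dl, with no loss from one scale to the next. *)
Let lift_on l := exists (psi : 'rV[R]_d -> R) (M : R),
  (forall x, cube l x -> circ (phi x - psi x) = 0 /\ `|psi x| <= M) /\
  (forall x y, cube l x -> cube l y -> cube l (x + y) ->
    `|psi (x + y) - psi x - psi y| <= 10 * dl).

Let lift_upgrade l (psi : 'rV[R]_d -> R) : l <= 2 ->
  (forall x, cube l x -> circ (phi x - psi x) = 0) ->
  (forall x y, cube l x -> cube l y -> cube l (x + y) ->
    `|psi (x + y) - psi x - psi y| <= 2) ->
  (forall x y, cube l x -> cube l y -> cube l (x + y) ->
    `|psi (x + y) - psi x - psi y| <= 10 * dl).
Proof.
move=> l2 hc h x y xl yl xyl; have c2 z : cube l z -> cube 2 (z : 'rV[R]_d).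
  exact: cube_le.
have := norm_le_cmod_cis (h x y xl yl xyl); rewrite -/(circ _).
have := phase_add (c2 _ xl) (c2 _ yl) (c2 _ xyl).
have -> : psi (x + y) - psi x - psi y = (phi (x + y) - phi x - phi y)
  - (phi (x + y) - psi (x + y)) + (phi x - psi x) + (phi y - psi y) by ring.
have := circD (phi (x + y) - phi x - phi y - (phi (x + y) - psi (x + y)) +
  (phi x - psi x)) (phi y - psi y).
have := circD (phi (x + y) - phi x - phi y - (phi (x + y) - psi (x + y)))
  (phi x - psi x).
have := circ_sub (phi (x + y) - phi x - phi y) (phi (x + y) - psi (x + y)).
rewrite !hc //; lra.
Qed.

Let lift_base : exists2 l, 0 < l & lift_on (Num.min l 2).
Proof.
have [l l0 hl] := phi_small; exists l => //; set l' := Num.min l 2.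
have l'l : l' <= l by rewrite ge_min lexx.
have l'2 : l' <= 2 by rewrite ge_min lexx orbT.
have /choice [psi hpsi] : forall x, exists s, cube l' x ->
    `|s| <= 1 / 4 /\ circ (phi x - s) = 0.
  move=> x; have [xl|xl] := pselect (cube l' x); last by exists 0.
  have h := hl x (cube_le l'l xl).
  have h8 : 1 / 8 <= 1 :> R by lra.
  have [s s4 e] := small_arg_exists h h8.
  exists s => _; split; first by lra.
  by rewrite -opprB circN; exact: circ_eq_cis.
exists psi, (1 / 4); split=> [x /hpsi[] //|].
apply: lift_upgrade => // [x /hpsi[] //|x y xl yl xyl].
have [h1 _] := hpsi _ xl; have [h2 _] := hpsi _ yl; have [h3 _] := hpsi _ xyl.
move: h1 h2 h3; rewrite !ler_norml => /andP[? ?] /andP[? ?] /andP[? ?].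
by apply/andP; split; lra.
Qed.

Let lift_step l : 2 * l <= 2 -> lift_on l -> lift_on (2 * l).
Proof.
move=> l2 [psi [M [hpsi hadd]]].
(* [2 * psi (x / 2)] is a lift of [phi x] only up to [dl]; the correction [th] makes it exact, as
   [lift_upgrade] requires. *)
have /choice [th hth] : forall x, exists s, cube (2 * l) x ->
    `|s| <= 2 * dl /\ circ (phi x - (2 * psi (2^-1 *: x) + s)) = 0.
  move=> x; have [xl|xl] := pselect (cube (2 * l) x); last by exists 0.
  have xl' := cube_half xl.
  have [hx _] := hpsi _ xl'.
  have h : circ (phi x - 2 * psi (2^-1 *: x)) <= dl.
    have := phase_double (cube_le l2 xl); set x' := 2^-1 *: x.
    have -> : phi x - 2 * psi x' = (phi x - 2 * phi x') + (phi x' - psi x') + (phi x' - psi x').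
      by ring.
    have := circD (phi x - 2 * phi x' + (phi x' - psi x')) (phi x' - psi x').
    have := circD (phi x - 2 * phi x') (phi x' - psi x').
    by rewrite hx; lra.
  have h8 : dl <= 1.
    have := dl_small; have := le_trans (circ_ge0 _) h; lra.
  have [s s4 e] := small_arg_exists h h8.
  exists s => _; split; first by lra.
  rewrite opprD addrA -opprB circN; exact: circ_eq_cis.
exists (fun x => 2 * psi (2^-1 *: x) + th x), (2 * M + 2 * dl); split.
  move=> x xl; have [h1 h2] := hth _ xl; split=> //.
  have [_ h3] := hpsi _ (cube_half xl).
  move: h1 h3; rewrite !ler_norml => /andP[? ?] /andP[? ?].
  by apply/andP; split; lra.
apply: lift_upgrade => // [x xl|x y xl yl xyl]; first by have [] := hth _ xl.
have [h1 _] := hth _ xl; have [h2 _] := hth _ yl; have [h3 _] := hth _ xyl.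
have := cube_half xyl; rewrite scalerDr => h4.
have := hadd _ _ (cube_half xl) (cube_half yl) h4.
move: h1 h2 h3; rewrite !ler_norml => /andP[? ?] /andP[? ?] /andP[? ?] /andP[? ?].
(* The new defect is at most 20 dl from [psi] plus 6 dl from three values of [th]: this is the 26 of
   [dl_small], and it stays below the 2 demanded by [lift_upgrade]. *)
by have := dl_small; move=> ?; apply/andP; split; lra.
Qed.

Lemma phase_linear : exists m : 'rV[R]_d, forall c, cube 2 c ->
  circ (phi c - dotv c m) <= (6 * d%:R + 1) * (10 * dl).
Proof.
have [l l0 [psi0 [M0 [hb0 ha0]]]] := lift_base.
(* Starting from a scale of the form 2 / 2^n lets n doublings end exactly at 2. *)
have [n hn] : exists n : nat, 2 / 2 ^+ n <= Num.min l 2.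
  have m0 : 0 < Num.min l 2 by rewrite lt_min l0 ltr0n.
  exists (Num.truncn (2 / Num.min l 2)).+1.
  have h : 2 / Num.min l 2 < (Num.truncn (2 / Num.min l 2)).+1%:R.
    by rewrite truncnS_gt ?divr_ge0 // ltW.
  set k := (Num.truncn _).+1 in h *.
  rewrite ler_pdivrMr ?exprn_gt0 //; rewrite ltr_pdivrMr // in h.
  apply: (le_trans (ltW h)); rewrite mulrC ler_wpM2l ?(ltW m0) //.
  by rewrite -natrX ler_nat ltnW // ltn_expl.
have base : lift_on (2 / 2 ^+ n).
  exists psi0, M0; split=> [x /(cube_le hn)/hb0 //|x y xl yl xyl].
  by apply: ha0; apply: cube_le hn _.
have lift2 : lift_on 2.
  clear hn; elim: n base => [|n IH]; first by rewrite expr0 divr1.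
  move=> h; apply: IH; have -> : 2 / 2 ^+ n = 2 * (2 / 2 ^+ n.+1) :> R.
    by rewrite exprS invfM mulrA mulrA mulfK.
  apply: lift_step => //.
  rewrite exprS invfM (mulrA 2 2^-1) divff // mul1r ger_pMr //.
  by rewrite invf_le1 ?exprn_gt0 // exprn_ege1 // ler1n.
have [psi [M [hb ha]]] := lift2.
exists (\row_i psi (delta_mx 0 i)) => c c2.
have -> : phi c - dotv c (\row_i psi (delta_mx 0 i)) =
   (phi c - psi c) + (psi c - \sum_i c 0 i * psi (delta_mx 0 i)).
  rewrite addrA subrK; congr (_ - _); apply: eq_bigr => i _.
  by rewrite mxE.
apply: le_trans (circD _ _) _; rewrite (hb c c2).1 add0r.
apply: le_trans (circ_le_norm _) _.
by apply: (approx_additive_cube (M := M)) => // x /hb[].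
Qed.

End PhaseLinear.

(** * Quadratic forms from an approximate parallelogram law *)

Section ModulusQuadratic.
Context {R : realType} {d : nat}.
Variables (q1 q2 : 'rV[R]_d -> R) (dl M : R).
Hypothesis mod_eq : forall x y, cube 4 x -> cube 4 y ->
  cube 4 (x + y) -> cube 4 (x - y) ->
  `|q1 (x + y) + q2 (x - y) - q1 x - q2 x - q1 y - q2 y| <= dl.
Hypothesis q1_0 : q1 0 = 0.
Hypothesis q2_0 : q2 0 = 0.
Hypothesis q1N : forall x, q1 (- x) = q1 x.
Hypothesis q2N : forall x, q2 (- x) = q2 x.
Hypothesis q1M : forall x, cube 4 x -> `|q1 x| <= M.

(** With y = x / 2, the pairs (y, y) and (y, - y) show that [q1 x] and [q2 x] are both within [dl]
    of [2 * q1 y + 2 * q2 y]. This is the origin of the common covariance matrix. *)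
Let q1q2 x : cube 4 x -> `|q1 x - q2 x| <= 2 * dl.
Proof.
move=> x4; set y := 2^-1 *: x.
have y4 : cube 4 y.
  apply: cube_le (cubeZ 2^-1 x4).
  by rewrite ger0_norm ?invr_ge0 //; lra.
have yy : y + y = x by rewrite -mulr2n -scaler_nat scalerA divff // scale1r.
have z4 : cube 4 (0 : 'rV[R]_d) by apply: cube0.
have := @mod_eq y y y4 y4; rewrite yy subrr q2_0 => /(_ x4 z4).
have := @mod_eq y (- y) y4 (cubeN y4).
rewrite opprK yy subrr q1_0 q1N q2N => /(_ z4 x4).
rewrite !ler_norml => /andP[? ?] /andP[? ?].
by apply/andP; split; lra.
Qed.

Let para x y : cube 4 x -> cube 4 y -> cube 4 (x + y) -> cube 4 (x - y) ->
  `|q1 (x + y) + q1 (x - y) - 2 * q1 x - 2 * q1 y| <= 7 * dl.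
Proof.
move=> x4 y4 xy4 xy4'; have := mod_eq x4 y4 xy4 xy4'.
have := q1q2 x4; have := q1q2 y4; have := q1q2 xy4'.
rewrite !ler_norml => /andP[? ?] /andP[? ?] /andP[? ?] /andP[? ?].
by apply/andP; split; lra.
Qed.

(* The polar form of q1, which is approximately additive in each variable. *)
Let b x y : R := (q1 (x + y) - q1 (x - y)) / 4.

Let b_sym x y : b x y = b y x.
Proof. by rewrite /b (addrC x) -(opprB y x) q1N. Qed.

Let c4 (x y : 'rV[R]_d) : cube 2 x -> cube 2 y -> cube 4 (x + y).
Proof. by move=> x2 y2; apply: cube_le (cubeD x2 y2); lra. Qed.

Let c4' (x y : 'rV[R]_d) : cube 2 x -> cube 2 y -> cube 4 (x - y).
Proof. by move=> x2 /cubeN; exact: c4. Qed.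

(** As in the Jordan-von Neumann argument, the parallelogram law at [(x + y, z)] minus that at
    [(x - y, z)] eliminates [q1 z]. *)
Let jensen x z y : cube 2 x -> cube 2 z -> cube 2 y ->
  cube 2 (x + z) -> cube 2 (x - z) ->
  `|b (x + z) y + b (x - z) y - 2 * b x y| <= 7 / 2 * dl.
Proof.
move=> x2 z2 y2 s2 d2; have z4 : cube 4 z by apply: cube_le z2; lra.
have e1 : x + y + z = x + z + y by rewrite addrAC.
have e2 : x + y - z = x - z + y by rewrite addrAC.
have e3 : x - y + z = x + z - y by rewrite addrAC.
have e4 : x - y - z = x - z - y by rewrite addrAC.
have := @para (x + y) z (c4 x2 y2) z4; rewrite e1 e2 => /(_ (c4 s2 y2) (c4 d2 y2)).
have := @para (x - y) z (c4' x2 y2) z4; rewrite e3 e4 => /(_ (c4' s2 y2) (c4' d2 y2)).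
rewrite /b !ler_norml => /andP[? ?] /andP[? ?].
by apply/andP; split; lra.
Qed.

(** Midpoint form of additivity: [jensen] at the half sum and half difference of [u] and [v], then
    once more on the diagonal, where [b 0 y = 0], to replace twice the midpoint value by
    [b (u + v) y]. *)
Let b_add y : cube 2 y -> forall u v, cube 2 u -> cube 2 v -> cube 2 (u + v) ->
  `|b (u + v) y - b u y - b v y| <= 7 * dl.
Proof.
move=> y2 u v u2 v2 uv2.
pose x := 2^-1 *: (u + v); pose z := 2^-1 *: (u - v).
have half : 2^-1 + 2^-1 = 1 :> R by lra.
have n2 : `|2^-1 : R| = 2^-1 by rewrite ger0_norm ?invr_ge0.
have x2 : cube 2 x.
  by apply: cube_le (cubeZ 2^-1 uv2); rewrite n2; lra.
have z2 : cube 2 z.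
  by apply: cube_le (cubeZ 2^-1 (cubeB u2 v2)); rewrite n2; lra.
have xzu : x + z = u.
  rewrite /x /z -scalerDr addrACA subrr addr0 -mulr2n -(scaler_nat 2 u) scalerA.
  by rewrite mulVf // scale1r.
have xzv : x - z = v.
  rewrite /x /z -scalerBr opprB [v - u]addrC addrACA subrr add0r -mulr2n.
  by rewrite -(scaler_nat 2 v) scalerA mulVf // scale1r.
have xx : x + x = u + v by rewrite -scalerDl half scale1r.
have b0 : b 0 y = 0 by rewrite /b add0r sub0r q1N subrr mul0r.
have := @jensen x z y x2 z2 y2; rewrite xzu xzv => /(_ u2 v2).
have := @jensen x x y x2 x2 y2; rewrite xx subrr b0 => /(_ uv2 (cube0 _)) h.
have {h} := h (ler0n _ _).
rewrite !ler_norml => /andP[? ?] /andP[? ?].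
by apply/andP; split; lra.
Qed.

Let b_bound x y : cube 2 x -> cube 2 y -> `|b x y| <= M.
Proof.
move=> x2 y2; have := q1M (c4 x2 y2); have := q1M (c4' x2 y2).
rewrite /b !ler_norml => /andP[? ?] /andP[? ?].
by apply/andP; split; lra.
Qed.

Let e2 i : cube 2 (delta_mx 0 i : 'rV[R]_d).
Proof. by apply: cube_le (cube_delta i); lra. Qed.

Let b_lin y c : cube 2 y -> cube 2 c ->
  `|b c y - \sum_i c 0 i * b (delta_mx 0 i) y| <= (6 * d%:R + 1) * (7 * dl).
Proof.
move=> y2 c2; apply: (@approx_additive_cube _ _ (fun x => b x y) _ M) => //.
  exact: b_add.
by move=> x x2; exact: b_bound.
Qed.

Let dl0 : 0 <= dl.
Proof.
have z4 : cube 4 (0 : 'rV[R]_d) by apply: cube0.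
by apply: le_trans (@mod_eq 0 0 z4 z4 _ _); rewrite ?addr0 ?subr0.
Qed.

(** The product is 4 (from [q1 c = 4 * b x x] with x = c / 2), times the 7 of [b_add], times the
    constant of [approx_additive_cube], with d + 1 linearisations: one in the first variable and d
    in the second. The final 2 passes from [q1] to [q2]. *)
Definition quad_const : R := 28 * (d%:R + 1) * (6 * d%:R + 1) + 2.

Lemma modulus_quadratic : exists2 B : 'M[R]_d, B^T = B & forall c, cube 2 c ->
  `|q1 c - (c *m B *m c^T) 0 0| <= quad_const * dl /\
  `|q2 c - (c *m B *m c^T) 0 0| <= quad_const * dl.
Proof.
pose B : 'M[R]_d := \matrix_(i, j) b (delta_mx 0 i) (delta_mx 0 j).
exists B; first by apply/matrixP => i j; rewrite !mxE b_sym.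
move=> c c2; set Q := (_ *m _) 0 0; set k := (6 * d%:R + 1) * (7 * dl).
have k0 : 0 <= k by rewrite mulr_ge0 ?mulr_ge0 // addr_ge0 // mulr_ge0.
have H : `|q1 c - Q| <= 4 * (d%:R + 1) * k.
  (* Halving brings the coordinates into [-1, 1], so they do not amplify the errors when the second
     variable is linearised. *)
  pose x := 2^-1 *: c.
  have x1 : cube 1 x.
    by apply: cube_le (cubeZ 2^-1 c2); rewrite ger0_norm ?invr_ge0 //; lra.
  have x2 : cube 2 x by apply: cube_le x1; lra.
  have qb : q1 c = 4 * b x x.
    rewrite /b subrr q1_0 subr0 mulrC divfK // /x -scalerDl.
    have -> : 2^-1 + 2^-1 = 1 :> R by lra.
    by rewrite scale1r.
  have QE : Q = 4 * \sum_i x 0 i * \sum_j x 0 j * B i j.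
    rewrite /Q !mxE mulr_sumr.
    under eq_bigr => j _ do rewrite !mxE mulr_suml.
    rewrite exchange_big; apply: eq_bigr => i _.
    rewrite !mulr_sumr; apply: eq_bigr => j _; rewrite /x !mxE.
    have h : 2 * 2^-1 = 1 :> R by rewrite divff.
    set a := 2^-1 in h *; transitivity ((2 * a) * (2 * a) * (c 0 i * B i j * c 0 j)).
      by rewrite h !mul1r /B mxE.
    by rewrite /B mxE; ring.
  have h1 := b_lin x2 x2.
  have h2 i : `|b (delta_mx 0 i) x - \sum_j x 0 j * B i j| <= k.
    rewrite b_sym; under eq_bigr => j _ do rewrite [B _ _]mxE b_sym.
    exact: b_lin.
  have h3 : `|\sum_i x 0 i * b (delta_mx 0 i) x - \sum_i x 0 i * \sum_j x 0 j * B i j|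
      <= d%:R * k.
    rewrite -sumrB; apply: le_trans (ler_norm_sum _ _ _) _.
    apply: le_trans (_ : \sum_(i < d) k <= _).
      apply: ler_sum => i _; rewrite -mulrBr normrM.
      have := ler_pM (normr_ge0 _) (normr_ge0 _) (x1 i) (h2 i).
      by rewrite mul1r.
    by rewrite sumr_const card_ord mulr_natl.
  rewrite qb QE; move: h1 h3; rewrite -/k.
  set s1 := \sum_i _; set s2 := \sum_i _.
  rewrite !ler_norml => /andP[? ?] /andP[? ?].
  by apply/andP; split; lra.
have e : quad_const * dl = 4 * (d%:R + 1) * k + 2 * dl.
  by rewrite /quad_const /k; ring.
have c44 : cube 4 c by apply: cube_le c2; lra.
move: H (q1q2 c44); rewrite e !ler_norml => /andP[? ?] /andP[? ?].
by have := dl0; split; apply/andP; split; lra.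
Qed.

End ModulusQuadratic.

(** * The functional equation on a cube *)

Section CfPair.
Context {R : realType}.

(** The interface between probability and analysis: everything used about the two characteristic
    functions. The radius in [cf_near0] is not uniform over pairs and enters no constant. *)
Record cf_pair (d : nat) (f g : 'rV[R]_d -> complex R) (eps : R) : Prop := CfPair {
  cf_f0 : f 0 = 1;
  cf_g0 : g 0 = 1;
  cf_f1 : forall x, cmod (f x) <= 1;
  cf_g1 : forall x, cmod (g x) <= 1;
  cf_fN : forall x, f (- x) = conjc (f x);
  cf_gN : forall x, g (- x) = conjc (g x);
  cf_near0 : forall e, 0 < e -> exists2 l, 0 < l & forall x, cube l x ->
    cmod (f x - 1) <= e /\ cmod (g x - 1) <= e;
  cf_eq : forall x y,
    cmod (f (x + y) * g (x - y) - f x * g x * (f y * g (- y))) <= eps }.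

Lemma cmod_conjc (z : complex R) : cmod (conjc z) = cmod z.
Proof. case: z => x y; exact: cmod_conj. Qed.

Lemma cf_pair_swap d (f g : 'rV[R]_d -> complex R) eps :
  cf_pair f g eps -> cf_pair g f eps.
Proof.
move=> H; split; try by case: H.
  by move=> e /(cf_near0 H)[l l0 hl]; exists l => // x /hl[].
move=> x y; have := cf_eq H x (- y); rewrite opprK => h.
rewrite [g (x + y) * _]mulrC [g x * _]mulrC [g y * _]mulrC; exact: h.
Qed.

Lemma cube_mulmx d (A : 'M[R]_d) : exists2 k, 0 < k &
  forall (l : R) (c : 'rV[R]_d), 0 <= l -> cube l c -> cube (k * l) (c *m A).
Proof.
pose k := 1 + \sum_i \sum_j `|A i j|.
have s0 : 0 <= \sum_i \sum_j `|A i j|.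
  by apply: sumr_ge0 => i _; apply: sumr_ge0 => j _.
exists k => [|l c l0 cl j]; first by rewrite /k; lra.
rewrite mxE; apply: le_trans (ler_norm_sum _ _ _) _.
apply: le_trans (_ : \sum_i `|A i j| * l <= _).
  by apply: ler_sum => i _; rewrite normrM mulrC ler_wpM2l.
rewrite -mulr_suml ler_wpM2r //.
apply: le_trans (_ : \sum_i \sum_j `|A i j| <= _); last by rewrite /k; lra.
apply: ler_sum => i _; rewrite (bigD1 j) //= lerDl.
by apply: sumr_ge0.
Qed.

(** The same [eps] before and after the substitution is what allows the near region to be normalised
    without loss. *)
Lemma cf_pair_mulmx d (f g : 'rV[R]_d -> complex R) eps (A : 'M[R]_d) :
  cf_pair f g eps -> cf_pair (fun c => f (c *m A)) (fun c => g (c *m A)) eps.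
Proof.
move=> H; split.
- by rewrite mul0mx (cf_f0 H).
- by rewrite mul0mx (cf_g0 H).
- by move=> x; exact: (cf_f1 H).
- by move=> x; exact: (cf_g1 H).
- by move=> x; rewrite mulNmx (cf_fN H).
- by move=> x; rewrite mulNmx (cf_gN H).
- move=> e /(cf_near0 H)[l l0 hl]; have [k k0 hk] := cube_mulmx A.
  exists (l / k) => [|x xl]; first by rewrite divr_gt0.
  apply: hl; have := hk _ _ _ xl; rewrite [k * _]mulrC divfK ?gt_eqF //.
  by apply; rewrite ltW // divr_gt0.
- by move=> x y; rewrite mulmxDl mulmxBl mulNmx; exact: (cf_eq H).
Qed.

End CfPair.

Section Core.
Context {R : realType}.

Lemma cmod_polar (r t : R) : cmod (Complex r 0 * cis t) = `|r|.
Proof. by rewrite cmodM cmod_cis mulr1 cmod_real. Qed.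

Lemma polarM (r s a b : R) :
  (Complex r 0 * cis a) * (Complex s 0 * cis b) = Complex (r * s) 0 * cis (a + b).
Proof.
rewrite cisD mulrACA; congr (_ * _).
by apply/eqP; rewrite eq_complex /= !(mul0r, mulr0) subr0 addr0 !eqxx.
Qed.

Lemma cisN (t : R) : cis (- t) = conjc (cis t).
Proof. by rewrite /cis cosN sinN. Qed.

(** One [e] is the hypothesis, the other pays for replacing the modulus [s] by [r]. *)
Lemma polar_circ_le (r s a b k e : R) : 0 < k -> k <= r -> k <= s ->
  cmod (Complex r 0 * cis a - Complex s 0 * cis b) <= e ->
  circ (a - b) <= 2 * e / k.
Proof.
move=> k0 kr ks h; rewrite circB.
have r0 : 0 < r by lra.
have s0 : 0 < s by lra.
have h1 : `|r - s| <= e.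
  apply: le_trans h; apply: le_trans (cmod_dist_norm _ _).
  by rewrite !cmod_polar (gtr0_norm r0) (gtr0_norm s0).
have h2 : r * cmod (cis a - cis b) <= 2 * e.
  have -> : r * cmod (cis a - cis b) = cmod (Complex r 0 * (cis a - cis b)).
    by rewrite cmodM cmod_real gtr0_norm.
  have -> : Complex r 0 * (cis a - cis b) =
     (Complex r 0 * cis a - Complex s 0 * cis b) + Complex (s - r) 0 * cis b.
    have -> : Complex (s - r) 0 = Complex s 0 - Complex r 0.
      by congr Complex; rewrite /= subr0.
    by rewrite mulrBr mulrBl addrA subrK.
  apply: le_trans (cmodD _ _) _; rewrite cmod_polar distrC; lra.
rewrite ler_pdivlMr // mulrC; apply: le_trans h2.
by rewrite ler_wpM2r // cmod_ge0.
Qed.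

Lemma polar_dist_le (a b p q n e : R) : 0 <= q -> `|q - p| <= n -> n <= 1 / 2 ->
  circ (a - b) <= e ->
  cmod (Complex (expR (- q)) 0 * cis a - Complex (expR (- p)) 0 * cis b)
    <= e + 2 * n.
Proof.
move=> q0 qp n1 h; rewrite circB in h.
have -> : Complex (expR (- q)) 0 * cis a - Complex (expR (- p)) 0 * cis b =
  Complex (expR (- q)) 0 * (cis a - cis b) +
  Complex (expR (- q) - expR (- p)) 0 * cis b.
  have -> : Complex (expR (- q) - expR (- p)) 0 =
     Complex (expR (- q)) 0 - Complex (expR (- p)) 0.
    by congr Complex; rewrite /= subr0.
  by rewrite mulrBr mulrBl addrA subrK.
apply: le_trans (cmodD _ _) _; rewrite cmod_polar.
apply: lerD; last exact: norm_expRB_le.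
rewrite cmodM cmod_real gtr0_norm ?expR_gt0 //.
have e1 : expR (- q) <= 1 by rewrite expR_le1; lra.
have := ler_pM (expR_ge0 _) (cmod_ge0 _) e1 h.
by rewrite mul1r.
Qed.

Definition core_const (d : nat) : R :=
  (6 * d%:R + 1) * 10 + 2 * @quad_const R d.

Lemma gauss_cf_polar d (m : 'rV[R]_d) (B : 'M[R]_d) (c : 'rV[R]_d) :
  gauss_cf m (2 *: B) c =
    Complex (expR (- (c *m B *m c^T) 0 0)) 0 * cis (dotv c m).
Proof.
rewrite /gauss_cf /cis; congr (Complex (expR _) 0 * _).
rewrite -scalemxAr -scalemxAl mxE; lra.
Qed.

Lemma quad_const_ge0 d : 0 <= @quad_const R d.
Proof. by rewrite /quad_const; have : 0 <= d%:R :> R by []; nra. Qed.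

(** Both sides of the equation have modulus at least [rho ^+ 4] on the cube, so it splits into an
    equation for arguments and one for logarithms of moduli, each with defect [2 * eps / rho ^+ 4].
    The two smallness conditions are those of [phase_linear] and [polar_dist_le]. *)
Lemma core d (f g : 'rV[R]_d -> complex R) (eps rho : R) :
  cf_pair f g eps -> 0 < rho <= 1 ->
  (forall c, cube 4 c -> rho <= cmod (f c) /\ rho <= cmod (g c)) ->
  26 * (2 * eps / rho ^+ 4) <= 1 ->
  @quad_const R d * (2 * eps / rho ^+ 4) <= 1 / 2 ->
  exists (m1 m2 : 'rV[R]_d) (Q : 'M[R]_d), Q^T = Q /\ forall c, cube 2 c ->
    cmod (f c - gauss_cf m1 Q c) <= core_const d * (2 * eps / rho ^+ 4) /\
    cmod (g c - gauss_cf m2 Q c) <= core_const d * (2 * eps / rho ^+ 4).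
Proof.
move=> H /andP[rho0 rho1] low; set dl := 2 * eps / rho ^+ 4 => dl26 dlq.
have eps0 : 0 <= eps by apply: le_trans (cf_eq H 0 0); rewrite cmod_ge0.
have r4 : 0 < rho ^+ 4 by rewrite exprn_gt0.
have dl0 : 0 <= dl by rewrite divr_ge0 ?mulr_ge0 // ltW.
have /choice [phi hphi] := fun x => polar_exists (f x).
have /choice [gam hgam] := fun x => polar_exists (g x).
have c42 x : cube 2 x -> cube 4 (x : 'rV[R]_d) by apply: cube_le; lra.
have hprod x y : f (x + y) * g (x - y) - f x * g x * (f y * g (- y)) =
  Complex (cmod (f (x + y)) * cmod (g (x - y))) 0 * cis (phi (x + y) + gam (x - y))
  - Complex (cmod (f x) * cmod (g x) * (cmod (f y) * cmod (g y))) 0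
    * cis (phi x + gam x + (phi y + gam (- y))).
  rewrite -(cmod_conjc (g y)) -(cf_gN H) -!polarM.
  by rewrite -!hphi -!hgam.
have lowl x y : cube 4 x -> cube 4 y -> rho ^+ 4 <= cmod (f x) * cmod (g y).
  move=> /low[h1 _] /low[_ h2]; apply: le_trans (_ : rho ^+ 2 <= _).
    by rewrite ler_wiXn2l // ltW.
  by rewrite expr2; apply: ler_pM => //; exact: ltW.
have lowr x y : cube 4 x -> cube 4 y ->
    rho ^+ 4 <= cmod (f x) * cmod (g x) * (cmod (f y) * cmod (g y)).
  move=> /low[h1 h2] /low[h3 h4]; rewrite (_ : rho ^+ 4 = rho * rho * (rho * rho)); last by ring.
  have r0 := ltW rho0.
  by apply: ler_pM; rewrite ?mulr_ge0 //; apply: ler_pM.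
have neg_phase (p : 'rV[R]_d -> R) (h : 'rV[R]_d -> complex R) :
  (forall x, h x = Complex (cmod (h x)) 0 * cis (p x)) ->
  (forall x, h (- x) = conjc (h x)) ->
  (forall x, cube 4 x -> rho <= cmod (h x)) ->
  forall z, cube 4 z -> circ (p z + p (- z)) = 0.
  move=> hp hN hl z z4; have h0 : 0 < cmod (h z) by apply: lt_le_trans (hl z z4).
  rewrite addrC -[p z]opprK; apply: circ_eq_cis.
  have := hp (- z); rewrite hN cmod_conjc {1}hp cisN.
  have -> : conjc (Complex (cmod (h z)) 0 * cis (p z)) =
     Complex (cmod (h z)) 0 * conjc (cis (p z)).
    rewrite /cis; apply/eqP; rewrite eq_complex /= !mul0r !subr0 !addr0.
    by rewrite mulrN eqxx /=.
  move/mulfI => ->//; apply/eqP => -[e]; by rewrite e ltxx in h0.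
have gamN := neg_phase gam g hgam (cf_gN H) (fun x h => (low x h).2).
have phiN := neg_phase phi f hphi (cf_fN H) (fun x h => (low x h).1).
have zero_phase (p : 'rV[R]_d -> R) (h : 'rV[R]_d -> complex R) :
  (forall x, h x = Complex (cmod (h x)) 0 * cis (p x)) -> h 0 = 1 -> circ (p 0) = 0.
  move=> hp h0; have := hp 0; rewrite h0 cmod1 -/1 mul1r => e.
  by rewrite -[p 0]subr0; apply: circ_eq_cis; rewrite -e cis0.
have near_phase (p : 'rV[R]_d -> R) (h : 'rV[R]_d -> complex R) :
  (forall x, h x = Complex (cmod (h x)) 0 * cis (p x)) ->
  forall x, cmod (h x - 1) <= 1 / 16 -> circ (p x) <= 1 / 8.
  move=> hp x hx; have h1 := cmod_dist_norm (h x) 1; rewrite cmod1 in h1.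
  have e : cis (p x) - 1 = (h x - 1) - Complex (cmod (h x) - 1) 0 * cis (p x).
    have -> : Complex (cmod (h x) - 1) 0 = Complex (cmod (h x)) 0 - 1.
      by congr Complex; rewrite /= subr0.
    by rewrite mulrBl mul1r -hp opprB [RHS]addrC -addrA [- h x + _]addrA addNr sub0r.
  rewrite /circ e; apply: le_trans (cmodD _ _) _.
  by rewrite cmodN cmod_polar; lra.
have [l l0 hl] := cf_near0 H (ltac:(lra) : 0 < 1 / 16 :> R).
have [m1 hm1] : exists m : 'rV[R]_d, forall c, cube 2 c ->
  circ (phi c - dotv c m) <= (6 * d%:R + 1) * (10 * dl).
  apply: (phase_linear (gam := gam)) => //.
  - move=> x y x2 y2 xy2 xy2'.
    have heq := cf_eq H x y; rewrite hprod in heq.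
    have := polar_circ_le r4 (lowl _ _ (c42 _ xy2) (c42 _ xy2'))
      (lowr _ _ (c42 _ x2) (c42 _ y2)) heq.
    rewrite -/dl => h.
    have -> : phi (x + y) + gam (x - y) - phi x - gam x - phi y + gam y =
      (phi (x + y) + gam (x - y) - (phi x + gam x + (phi y + gam (- y)))) +
      (gam y + gam (- y)) by ring.
    apply: le_trans (circD _ _) _; rewrite gamN; last exact: c42.
    by rewrite addr0.
  - exact: zero_phase hgam (cf_g0 H).
  - by move=> z /c42; exact: gamN.
  - by exists l => // x /hl[h _]; exact: near_phase hphi _ h.
(* Replacing [y] by [- y] in the equation exchanges the roles of [f] and [g]. *)
have [m2 hm2] : exists m : 'rV[R]_d, forall c, cube 2 c ->
  circ (gam c - dotv c m) <= (6 * d%:R + 1) * (10 * dl).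
  apply: (phase_linear (gam := phi)) => //.
  - move=> x y x2 y2 xy2 xy2'.
    have heq := cf_eq H x (- y); rewrite hprod !opprK in heq.
    have := polar_circ_le r4 (lowl _ _ (c42 _ xy2') (c42 _ xy2))
      (lowr _ _ (c42 _ x2) (cubeN (c42 _ y2))) heq.
    rewrite -/dl => h.
    have -> : gam (x + y) + phi (x - y) - gam x - phi x - gam y + phi y =
      (phi (x - y) + gam (x + y) - (phi x + gam x + (phi (- y) + gam y))) +
      (phi y + phi (- y)) by ring.
    apply: le_trans (circD _ _) _; rewrite phiN; last exact: c42.
    by rewrite addr0.
  - exact: zero_phase hphi (cf_f0 H).
  - by move=> z /c42; exact: phiN.
  - by exists l => // x /hl[_ h]; exact: near_phase hgam _ h.
pose q1 x := - ln (cmod (f x)); pose q2 x := - ln (cmod (g x)).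
have [|||||x x4|B Bs hB] := @modulus_quadratic R d q1 q2 dl (- ln rho).
- move=> x y x4 y4 xy4 xy4'.
  have [fx gx] := low _ x4; have [fy gy] := low _ y4.
  have [fxy _] := low _ xy4; have [_ gxy] := low _ xy4'.
  have h : `|cmod (f (x + y)) * cmod (g (x - y)) -
     cmod (f x) * cmod (g x) * (cmod (f y) * cmod (g y))| <= eps.
    apply: le_trans (cf_eq H x y); apply: le_trans (cmod_dist_norm _ _).
    by rewrite !cmodM (cf_gN H) cmod_conjc.
  have := norm_lnB_le r4 (lowl _ _ xy4 xy4') (lowr _ _ x4 y4) h.
  have pos z : rho <= z -> 0 < z by exact: lt_le_trans.
  rewrite !lnM ?posrE ?mulr_gt0 ?pos //.
  move=> {}h; have -> : q1 (x + y) + q2 (x - y) - q1 x - q2 x - q1 y - q2 y =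
    - (ln (cmod (f (x + y))) + ln (cmod (g (x - y))) -
      (ln (cmod (f x)) + ln (cmod (g x)) + (ln (cmod (f y)) + ln (cmod (g y))))).
    by rewrite /q1 /q2; ring.
  rewrite normrN; apply: (le_trans h); rewrite /dl -mulrA.
  have : 0 <= eps / rho ^+ 4 by rewrite divr_ge0 // ltW.
  lra.
- by rewrite /q1 (cf_f0 H) cmod1 ln1 oppr0.
- by rewrite /q2 (cf_g0 H) cmod1 ln1 oppr0.
- by move=> x; rewrite /q1 (cf_fN H) cmod_conjc.
- by move=> x; rewrite /q2 (cf_gN H) cmod_conjc.
- have [h _] := low _ x4.
  have h1 : ln (cmod (f x)) <= 0 by rewrite ln_le0 // (cf_f1 H).
  have h2 : ln rho <= ln (cmod (f x)).
    by rewrite ler_ln // posrE //; exact: lt_le_trans h.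
  by rewrite ger0_norm /q1; lra.
(* The factor 2 compensates the 1/2 in the exponent of [gauss_cf]. *)
exists m1, m2, (2 *: B); split; first by rewrite linearZ /= Bs.
move=> c c2; have [B1 B2] := hB c c2.
have [fc gc] := low _ (c42 _ c2).
have expE z : rho <= z -> Complex z 0 = Complex (expR (- - ln z)) 0.
  by move=> h; rewrite opprK lnK // posrE; exact: lt_le_trans h.
have e1 : core_const d * dl = (6 * d%:R + 1) * (10 * dl) + 2 * (@quad_const R d * dl).
  by rewrite /core_const; ring.
rewrite e1 !gauss_cf_polar; split.
  rewrite hphi (expE _ fc); apply: polar_dist_le => //; last exact: hm1.
  by rewrite oppr_ge0 ln_le0 // (cf_f1 H).
rewrite hgam (expE _ gc); apply: polar_dist_le => //; last exact: hm2.
by rewrite oppr_ge0 ln_le0 // (cf_g1 H).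
Qed.

End Core.

(** * The near region *)

Section NearMaxDet.
Context {R : realType} {d : nat}.
Implicit Types (A : 'M[R]_d) (x : 'rV[R]_d).

Definition row_subst A x (i : 'I_d) : 'M[R]_d :=
  \matrix_(k, j) if k == i then x 0 j else A k j.

Lemma mulmx_adj_row_subst A x i : (x *m \adj A) 0 i = \det (row_subst A x i).
Proof.
rewrite (expand_det_row _ i) mxE; apply: eq_bigr => j _.
rewrite !mxE eqxx; congr (_ * _); rewrite /cofactor; congr (_ * \det _).
by apply/matrixP => k l; rewrite !mxE eq_sym (negbTE (neq_lift _ _)).
Qed.

(* By Cramer's rule the coordinates of x in the basis of rows of A are the ratios
   [\det (row_subst A x i) / \det A], bounded by 2 once |\det A| is at least half
   of the supremum over all families of vectors of S. *)
Lemma near_max_det (S : 'rV[R]_d -> Prop) (b l : R) : 0 < l ->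
  (forall x, cube l x -> S x) -> (forall x, S x -> cube b x) ->
  exists A, [/\ forall i, S (row i A), A \in unitmx &
    forall x, S x -> cube 2 (x *m invmx A)].
Proof.
move=> l0 lS Sb.
pose E := [set v | exists A, (forall i, S (row i A)) /\ v = `|\det A|].
(* The scaled identity makes the supremum positive, so a nearly maximal family is invertible. *)
have El : E (l ^+ d).
  exists (l%:M); split; last by rewrite det_scalar ger0_norm // exprn_ge0 // ltW.
  move=> i; apply: lS => j; rewrite !mxE.
  by case: (i == j); rewrite ?mulr1n ?mulr0n ?normr0 ?gtr0_norm // ltW.
have l0d : 0 < l ^+ d by rewrite exprn_gt0.
have Eb : has_sup E.
  split; first by exists (l ^+ d).
  exists (\sum_(s : {perm 'I_d}) b ^+ d) => v [A [AS ->]].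
  rewrite /determinant; apply: le_trans (ler_norm_sum _ _ _) _.
  apply: ler_sum => s _; rewrite normrM normrX normrN1 expr1n mul1r normr_prod.
  apply: le_trans (_ : \prod_(i < d) b <= _); last by rewrite prodr_const card_ord.
  apply: ler_prod => i _; rewrite normr_ge0 /=.
  by have := Sb _ (AS i) (s i); rewrite mxE.
have supl : l ^+ d <= sup E by apply: sup_upper_bound.
have s2 : 0 < sup E / 2 by lra.
have [v [A [AS ->]] hA] := sup_adherent s2 Eb.
have {}hA : sup E / 2 < `|\det A| by lra.
have dA : 0 < `|\det A| by lra.
have uA : A \in unitmx by rewrite unitmxE unitfE -normr_gt0.
exists A; split => // x Sx i.
rewrite /invmx uA -scalemxAr mxE mulmx_adj_row_subst normrM normfV.
rewrite mulrC ler_pdivrMr //.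
apply: le_trans (_ : sup E <= _); last by lra.
apply: sup_upper_bound => //; exists (row_subst A x i); split=> // k.
have [->|ki] := eqVneq k i.
  by have -> : row i (row_subst A x i) = x
    by apply/rowP => j; rewrite !mxE eqxx.
have -> : row k (row_subst A x i) = row k A
  by apply/rowP => j; rewrite !mxE (negbTE ki).
exact: AS.
Qed.

End NearMaxDet.

Section NearRegion.
Context {R : realType} {d : nat}.
Variables (f g : 'rV[R]_d -> complex R) (eps : R).
Hypothesis H : cf_pair f g eps.

Definition above (r : R) (x : 'rV[R]_d) := r <= cmod (f x) /\ r <= cmod (g x).

(** Quantifying over the whole segment makes the set star-shaped about 0. The value 1/32 is small
    enough to be recovered after one doubling, see [double_in]. *)
Definition near_region (x : 'rV[R]_d) :=
  forall s : R, 0 <= s <= 1 -> above (1 / 32) (s *: x).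

Lemma above_le r r' x : r' <= r -> above r x -> above r' x.
Proof. by move=> rr [h1 h2]; split; exact: le_trans rr _. Qed.

Lemma above_opp r x : above r x -> above r (- x).
Proof. by rewrite /above (cf_fN H) (cf_gN H) !cmod_conjc. Qed.

(** The fourfold product is at least [r ^+ 4], and [r ^+ 4 - eps >= r ^+ 5] because [r <= 1 / 2]; on
    the other side one of the two factors is at most 1 in modulus. *)
Lemma above_add r x y : 0 < r <= 1 / 2 -> eps <= r ^+ 5 ->
  above r x -> above r y -> above (r ^+ 5) (x + y).
Proof.
move=> /andP[r0 r1] er [fx gx] [fy gy].
have r4 : 0 < r ^+ 4 by rewrite exprn_gt0.
have e5 : r ^+ 5 = r * r ^+ 4 by rewrite exprS.
have e4 : r ^+ 4 = r * r * (r * r) by ring.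
have prod_ge : r ^+ 4 <= cmod (f x * g x * (f y * g y)).
  by have := ltW r0; rewrite !cmodM e4 => ?; do !apply: ler_pM; rewrite ?mulr_ge0.
have h5 : r ^+ 5 <= r ^+ 4 - eps by nra.
split; apply: (le_trans h5).
  have := cf_eq H x y; have := cmod_lerB (f x * g x * (f y * g (- y))) (f (x + y) * g (x - y)).
  rewrite cmodB; have -> : cmod (f x * g x * (f y * g (- y))) = cmod (f x * g x * (f y * g y)).
    by rewrite !cmodM (cf_gN H) cmod_conjc.
  have : cmod (f (x + y) * g (x - y)) <= cmod (f (x + y)).
    by rewrite cmodM ler_piMr ?cmod_ge0 ?(cf_g1 H).
  lra.
have := cf_eq H x (- y); rewrite opprK.
have := cmod_lerB (f x * g x * (f (- y) * g y)) (f (x - y) * g (x + y)).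
rewrite cmodB; have -> : cmod (f x * g x * (f (- y) * g y)) = cmod (f x * g x * (f y * g y)).
  by rewrite !cmodM (cf_fN H) cmod_conjc.
have : cmod (f (x - y) * g (x + y)) <= cmod (g (x + y)).
  by rewrite cmodM ler_piMl ?cmod_ge0 ?(cf_f1 H).
lra.
Qed.

(* Each addition of arguments costs a fifth power in the lower bound on |f|, |g|
   (see [above_add]), hence the tower 5 ^ k. *)
Definition level (k : nat) : R := (1 / 32) ^+ (5 ^ k).

Lemma levelS k : level k.+1 = level k ^+ 5.
Proof. by rewrite /level expnSr exprM. Qed.

Lemma level_gt0 k : 0 < level k.
Proof. by rewrite exprn_gt0. Qed.

Lemma level_le k k' : (k <= k')%N -> level k' <= level k.
Proof.
move=> kk; rewrite /level ler_wiXn2l //; try lra.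
by rewrite leq_exp2l.
Qed.

Lemma level_half k : 0 < level k <= 1 / 2.
Proof.
rewrite level_gt0 /=; apply: le_trans (level_le (leq0n k)) _.
by rewrite /level expn0 expr1; lra.
Qed.

Lemma near_region_line x c : near_region x -> eps <= level 2 -> `|c| <= 4 ->
  above (level 2) (c *: x).
Proof.
move=> nx e2 c4.
have a0 : above (level 0) ((c / 4) *: x).
  have e0 : level 0 = 1 / 32 by rewrite /level expn0 expr1.
  rewrite e0; move: c4; rewrite ler_norml => /andP[? ?]; case: (leP 0 c) => c0.
    by apply: nx; apply/andP; split; lra.
  by rewrite -[_ *: x]opprK -scaleNr; apply/above_opp/nx; apply/andP; split; lra.
have dbl t : (t + t) *: x = t *: x + t *: x by rewrite scalerDl.
have a1 : above (level 1) ((c / 2) *: x).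
  have -> : c / 2 = c / 4 + c / 4 by lra.
  rewrite dbl levelS; apply: above_add => //; first exact: level_half.
  by rewrite -levelS; apply: le_trans e2 (level_le _).
have -> : c = c / 2 + c / 2 by lra.
by rewrite dbl levelS; apply: above_add; rewrite -?levelS //; exact: level_half.
Qed.

(** Two levels are spent on stretching each row by a factor up to 4, and d on adding the d rows. *)
Lemma near_region_cube (A : 'M[R]_d) : (forall i, near_region (row i A)) ->
  eps <= level (d + 2) -> forall c, cube 4 c -> above (level (d + 2)) (c *m A).
Proof.
move=> nA ed c c4.
have e2 : eps <= level 2 by apply: le_trans ed (level_le _); rewrite leq_addl.
have main (r : seq 'I_d) : (size r <= d)%N ->
    above (level (size r + 2)) (\sum_(i <- r) c 0 i *: row i A).
  elim: r => [_|i r IH /= rd].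
    rewrite big_nil /above (cf_f0 H) (cf_g0 H) cmod1.
    by have /andP[_ h] := level_half (0 + 2); split; apply: le_trans h _; lra.
  rewrite big_cons addSn levelS.
  have er : eps <= level (size r + 2) ^+ 5.
    by rewrite -levelS -addSn; apply: le_trans ed (level_le _); rewrite leq_add2r.
  apply: above_add (level_half _) er _ (IH (ltnW rd)).
  by apply: above_le (near_region_line (nA i) e2 (c4 i)); rewrite level_le ?leq_addl.
have := main (index_enum 'I_d).
have -> : size (index_enum 'I_d) = d.
  by rewrite [index_enum _]unlock -enumT size_enum_ord.
by rewrite -mulmx_sum_row; apply.
Qed.

Definition near_const : R := @core_const R d * (2 / level (d + 2) ^+ 4).

(** With r = [level (d + 2)], this bounds [eps / r ^+ 4] by r / (100 (q + 1)), where q is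
    [quad_const]; all smallness conditions of [near_threshold_small] follow. *)
Definition near_threshold : R :=
  level (d + 2) ^+ 4 * level (d + 2) / (100 * (@quad_const R d + 1)).

Lemma near_region_cubeP : exists2 l, 0 < l & forall x, cube l x -> near_region x.
Proof.
have [l l0 hl] := cf_near0 H (ltac:(lra) : 0 < 1 / 2 :> R).
exists l => // x xl s /andP[s0 s1].
have : cube l (s *: x).
  apply: cube_le (cubeZ s xl); rewrite ger0_norm //; have := ltW l0; nra.
move=> /hl[h1 h2]; have := cmod_lerB 1 (f (s *: x)); have := cmod_lerB 1 (g (s *: x)).
by rewrite !(cmodB 1) cmod1; split; lra.
Qed.

Lemma near_threshold_small : eps <= near_threshold ->
  [/\ eps <= level (d + 2), 26 * (2 * eps / level (d + 2) ^+ 4) <= 1 &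
  @quad_const R d * (2 * eps / level (d + 2) ^+ 4) <= 1 / 2].
Proof.
rewrite /near_threshold; set r := level (d + 2); set q := @quad_const R d => h.
have /andP[r0 r1] : 0 < r <= 1 / 2 := level_half _.
have r4 : 0 < r ^+ 4 by rewrite exprn_gt0.
have q0 : 0 <= q := quad_const_ge0 d.
have q1 : 0 < 100 * (q + 1) by lra.
have rr : r ^+ 4 <= 1 by rewrite exprn_ile1 //; lra.
have eps0 : 0 <= eps by apply: le_trans (cf_eq H 0 0); rewrite cmod_ge0.
rewrite ler_pdivlMr // in h.
pose t := eps / r ^+ 4.
have et : eps = t * r ^+ 4 by rewrite /t divfK // gt_eqF.
have t0 : 0 <= t by rewrite divr_ge0 // ltW.
have -> : 2 * eps / r ^+ 4 = 2 * t by rewrite /t mulrA.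
have ht : t * (100 * (q + 1)) <= r.
  by rewrite -(ler_pM2r r4) mulrAC -et [r * _]mulrC.
have tq : 0 <= t * q by rewrite mulr_ge0.
split; last 2 first; [lra|lra|].
rewrite et; apply: le_trans (_ : t * 1 <= _); last lra.
by rewrite ler_wpM2l.
Qed.

Lemma near_gauss_box (b : R) : 0 < b -> eps <= near_threshold ->
  exists (m1 m2 : 'rV[R]_d) (Q : 'M[R]_d), Q^T = Q /\
    forall x, near_region x -> cube b x ->
      cmod (f x - gauss_cf m1 Q x) <= near_const * eps /\
      cmod (g x - gauss_cf m2 Q x) <= near_const * eps.
Proof.
move=> b0 /near_threshold_small[e1 e2 e3].
have [l l0 hl] := near_region_cubeP.
have m0 : 0 < Num.min l b by rewrite lt_min l0 b0.
have [x xl|x []//|A [AS uA hA]] :=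
  @near_max_det R d (fun x => near_region x /\ cube b x) b _ m0.
  by split; [apply/hl|]; apply: cube_le xl; rewrite ge_min lexx ?orbT.
have r01 : 0 < level (d + 2) <= 1.
  by have /andP[-> h] := level_half (d + 2); apply: le_trans h _; lra.
have nA := near_region_cube (fun i => (AS i).1) e1.
have [m1 [m2 [Q [Qs hQ]]]] := core (cf_pair_mulmx A H) r01 nA e2 e3.
(* The Gaussian found in the coordinates of the basis [A] is carried back to the original ones. *)
exists (m1 *m (invmx A)^T), (m2 *m (invmx A)^T), (invmx A *m Q *m (invmx A)^T).
split; first by rewrite !trmx_mul trmxK Qs mulmxA.
move=> x nx bx.
have [] := hQ _ (hA x (conj nx bx)); rewrite mulmxKV //.
have -> : near_const * eps = @core_const R d * (2 * eps / level (d + 2) ^+ 4).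
  by rewrite /near_const; ring.
have gE m : gauss_cf m Q (x *m invmx A) =
    gauss_cf (m *m (invmx A)^T) (invmx A *m Q *m (invmx A)^T) x.
  have dE : dotv (x *m invmx A) m = dotv x (m *m (invmx A)^T).
    have dotE (u v : 'rV[R]_d) : dotv u v = (u *m v^T) 0 0.
      by rewrite mxE; apply: eq_bigr => i _; rewrite mxE.
    by rewrite !dotE trmx_mul trmxK mulmxA.
  by rewrite /gauss_cf dE trmx_mul !mulmxA.
by rewrite !gE.
Qed.

End NearRegion.

(** * From the near region to the whole space *)

Section GaussCf.
Context {R : realType} {d : nat}.
Implicit Types (m x y : 'rV[R]_d) (Q : 'M[R]_d).

Definition qform Q x : R := (x *m Q *m x^T) 0 0.

Lemma qformZ Q s x : qform Q (s *: x) = s ^+ 2 * qform Q x.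
Proof.
by rewrite /qform linearZ /= -!scalemxAl -scalemxAr scalerA mxE.
Qed.

Lemma qformN Q x : qform Q (- x) = qform Q x.
Proof. by rewrite -(scaleN1r x) qformZ sqrrN expr1n mul1r. Qed.

Lemma qformD Q x y : Q^T = Q ->
  qform Q (x + y) = qform Q x + qform Q y + 2 * (x *m Q *m y^T) 0 0.
Proof.
move=> Qs; have e : (y *m Q *m x^T) 0 0 = (x *m Q *m y^T) 0 0.
  transitivity ((y *m Q *m x^T)^T 0 0); first by rewrite [RHS]mxE.
  by rewrite !trmx_mul trmxK Qs mulmxA.
rewrite /qform linearD /= mulmxDl mulmxDl !mulmxDr.
have aD (M N : 'M[R]_1) : (M + N) 0 0 = M 0 0 + N 0 0 by rewrite mxE.
rewrite !aD e; ring.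
Qed.

Lemma qform_sum Q x : qform Q x = \sum_j (\sum_i x 0 i * Q i j) * x 0 j.
Proof. by rewrite /qform mxE; apply: eq_bigr => j _; rewrite !mxE. Qed.

Lemma dotvZ s x m : dotv (s *: x) m = s * dotv x m.
Proof. by rewrite /dotv mulr_sumr; apply: eq_bigr => i _; rewrite mxE mulrA. Qed.

Lemma dotvDl x y m : dotv (x + y) m = dotv x m + dotv y m.
Proof. by rewrite /dotv -big_split; apply: eq_bigr => i _; rewrite mxE mulrDl. Qed.

Lemma dotvNl x m : dotv (- x) m = - dotv x m.
Proof. by rewrite -scaleN1r dotvZ mulN1r. Qed.

Lemma dotv_delta s i m : dotv (s *: delta_mx 0 i) m = s * m 0 i.
Proof.
rewrite dotvZ /dotv (bigD1 i) //= big1 => [|j ji]; last first.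
  by rewrite mxE eqxx (negbTE ji) mul0r.
by rewrite mxE !eqxx mul1r addr0.
Qed.

Definition gauss_mod Q x : R := expR (- (1 / 2) * qform Q x).

Lemma gauss_cfE m Q x : gauss_cf m Q x = Complex (gauss_mod Q x) 0 * cis (dotv x m).
Proof. by []. Qed.

Lemma cmod_gauss m Q x : cmod (gauss_cf m Q x) = gauss_mod Q x.
Proof. by rewrite gauss_cfE cmod_polar gtr0_norm ?expR_gt0. Qed.

Lemma gauss_cf_rect m Q x : gauss_cf m Q x =
  Complex (gauss_mod Q x * cos (dotv x m)) (gauss_mod Q x * sin (dotv x m)).
Proof.
rewrite gauss_cfE /cis; apply/eqP; rewrite eq_complex /= !mul0r subr0 addr0.
by rewrite !eqxx.
Qed.

Lemma gauss_cf_opp m Q x : gauss_cf m Q (- x) = conjc (gauss_cf m Q x).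
Proof.
rewrite !gauss_cf_rect dotvNl cosN sinN mulrN /gauss_mod.
by rewrite qformN.
Qed.

Lemma gauss_mod_double Q x : gauss_mod Q (x + x) = gauss_mod Q x ^+ 4.
Proof.
rewrite /gauss_mod -expRM_natl -[x in qform Q (x + x)]scale1r -scalerDl qformZ.
congr expR; ring.
Qed.

(** Gaussians with a common [Q] satisfy the functional equation exactly; this is its diagonal case,
    to be compared with [cf_eq] in [double_error]. *)
Lemma gauss_cf_double m1 m2 Q x : gauss_cf m1 Q (x + x) =
  gauss_cf m1 Q x * gauss_cf m2 Q x * (gauss_cf m1 Q x * gauss_cf m2 Q (- x)).
Proof.
rewrite !gauss_cfE !polarM; congr (Complex _ 0 * cis _).
  rewrite gauss_mod_double (_ : gauss_mod Q (- x) = gauss_mod Q x); first by ring.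
  by rewrite /gauss_mod qformN.
by rewrite dotvDl dotvNl; ring.
Qed.

End GaussCf.

(** * Limits of Gaussian parameters *)

Section Limit.
Context {R : realType} {d : nat}.

(** An ultrafilter replaces successive extractions of subsequences: a single [U] makes all
    coordinates of both means and of the matrix converge. *)
Lemma ultra_bounded_cvg (T : Type) (U : set_system T) (u : T -> R) (K : R) :
  UltraFilter U -> (forall n, `|u n| <= K) -> exists p : R, u n @[n --> U] --> p.
Proof.
move=> UU uK.
have [p [_ cp]] : `[- K, K]%classic `&` cluster (u @ U) !=set0.
  apply: segment_compact; rewrite nbhs_simpl /=; apply: filterE => n.
  by rewrite /= in_itv /= -ler_norml.
exists p => B Bp.
have [//|nB] := in_ultra_setVsetC (u @^-1` B) UU.
have [x [nBx Bx]] := cp (~` B) B nB Bp.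
by [].
Qed.

Lemma cmod_le_sqr (a b K : R) : 0 <= K ->
  (cmod (Complex a b) <= K) = (a ^+ 2 + b ^+ 2 <= K ^+ 2).
Proof.
move=> K0; rewrite cmod_def -(ler_sqr (x := Num.sqrt _)) ?nnegrE ?sqrtr_ge0 //.
by rewrite sqr_sqrtr // addr_ge0 // sqr_ge0.
Qed.

Lemma cvg_sumr (T : Type) (U : set_system T) (I : Type) (r : seq I)
    (F : I -> T -> R) (G : I -> R) : Filter U ->
  (forall i, F i n @[n --> U] --> G i) ->
  \sum_(i <- r) F i n @[n --> U] --> \sum_(i <- r) G i.
Proof.
move=> FU FG; apply: (@cvg_big _ _ +%R 0 xpredT) => //.
by move=> [x y]; exact: add_continuous.
Qed.

Lemma gauss_limit (T : Type) (U : set_system T) (m_ : T -> 'rV[R]_d)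
    (Q_ : T -> 'M[R]_d) (m : 'rV[R]_d) (Q : 'M[R]_d) (x : 'rV[R]_d) (z : complex R) (K : R) :
  ProperFilter U -> 0 <= K ->
  (forall i, m_ n 0 i @[n --> U] --> (m 0 i : R)) ->
  (forall i j, Q_ n i j @[n --> U] --> (Q i j : R)) ->
  (\forall n \near U, cmod (z - gauss_cf (m_ n) (Q_ n) x) <= K) ->
  cmod (z - gauss_cf m Q x) <= K.
Proof.
move=> PU K0 mc Qc zK.
have dc : dotv x (m_ n) @[n --> U] --> dotv x m.
  by apply: cvg_sumr => i; apply: cvgMl_tmp; exact: mc.
have qc : qform (Q_ n) x @[n --> U] --> qform Q x.
  rewrite qform_sum; under eq_cvg do rewrite qform_sum.
  apply: cvg_sumr => j; apply: cvgMr_tmp; apply: cvg_sumr => i.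
  by apply: cvgMl_tmp; exact: Qc.
have gc : gauss_mod (Q_ n) x @[n --> U] --> gauss_mod Q x.
  apply: (continuous_cvg _ (h := @expR R)); first exact: continuous_expR.
  by apply: cvgMl_tmp.
have cc : cos (dotv x (m_ n)) @[n --> U] --> cos (dotv x m).
  by apply: (continuous_cvg _ (h := @cos R)) dc; exact: continuous_cos.
have sc : sin (dotv x (m_ n)) @[n --> U] --> sin (dotv x m).
  by apply: (continuous_cvg _ (h := @sin R)) dc; exact: continuous_sin.
case: z zK => a b zK.
have E (m' : 'rV[R]_d) (Q' : 'M[R]_d) : (cmod (Complex a b - gauss_cf m' Q' x) <= K) =
   ((a - gauss_mod Q' x * cos (dotv x m')) ^+ 2 +
    (b - gauss_mod Q' x * sin (dotv x m')) ^+ 2 <= K ^+ 2).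
  by rewrite gauss_cf_rect -cmod_le_sqr.
rewrite E; apply: (@cvgr_to_le _ U _ _ (fun n =>
  (a - gauss_mod (Q_ n) x * cos (dotv x (m_ n))) ^+ 2 +
  (b - gauss_mod (Q_ n) x * sin (dotv x (m_ n))) ^+ 2)); last first.
  by apply: filterS zK => n; rewrite E.
have c1 : a - gauss_mod (Q_ n) x * cos (dotv x (m_ n)) @[n --> U] -->
    a - gauss_mod Q x * cos (dotv x m).
  by apply: cvgB; [exact: cvg_cst | exact: cvgM].
have c2 : b - gauss_mod (Q_ n) x * sin (dotv x (m_ n)) @[n --> U] -->
    b - gauss_mod Q x * sin (dotv x m).
  by apply: cvgB; [exact: cvg_cst | exact: cvgM].
by apply: cvgD; rewrite expr2; under eq_cvg do rewrite expr2; exact: cvgM.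
Qed.

End Limit.

Section NearGauss.
Context {R : realType} {d : nat}.

(* A phase |m_i| > pi / l would make cos (dotv x m) equal to -1 inside the cube. *)
Lemma gauss_near1_bounds (m : 'rV[R]_d) Q (l : R) : 0 < l -> Q^T = Q ->
  (forall x, cube l x -> cmod (gauss_cf m Q x - 1) <= 1 / 4) ->
  (forall i, `|m 0 i| <= pi / l) /\ (forall i j, `|Q i j| <= 6 / l ^+ 2).
Proof.
move=> l0 Qs H; have ln : l != 0 by rewrite gt_eqF.
have delta_cube s i : `|s| <= l -> cube l (s *: (delta_mx 0 i : 'rV[R]_d)).
  move=> sl; apply: cube_le (cubeZ s (cube_delta i)); by rewrite mulr1.
split.
  move=> i; rewrite leNgt; apply/negP => hm.
  have m0 : 0 < `|m 0 i| by apply: lt_trans hm; rewrite divr_gt0 ?pi_gt0.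
  pose s : R := pi / m 0 i.
  have sl : `|s| <= l.
    rewrite normrM normfV (gtr0_norm (pi_gt0 R)) ler_pdivrMr // mulrC.
    by rewrite -ler_pdivrMr // ltW.
  have := H _ (delta_cube s i sl).
  rewrite gauss_cf_rect dotv_delta divfK; last by rewrite -normr_gt0.
  set g := gauss_mod _ _; have g0 : 0 < g by exact: expR_gt0.
  rewrite cospi sinpi => h.
  have := le_trans (ge_cmod_Re _ _) h; rewrite ler_norml => /andP[+ _].
  by lra.
have qb x : cube l x -> `|qform Q x| <= 1.
  move=> xl; have h := le_trans (cmod_dist_norm _ _) (H x xl).
  move: h; rewrite cmod_gauss cmod1 /gauss_mod; set v := qform Q x.
  have h1 := expR_ge1Dx (- (1 / 2) * v).
  have h2 := expR_ge1Dx (1 / 2 * v).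
  have h3 : expR (- (1 / 2) * v) * expR (1 / 2 * v) = 1.
    by rewrite -expRD mulNr addNr expR0.
  rewrite !ler_norml => /andP[h4 h5]; apply/andP; split; first by lra.
  have : 3 / 4 * expR (1 / 2 * v) <= expR (- (1 / 2) * v) * expR (1 / 2 * v).
    by rewrite ler_wpM2r ?expR_ge0 //; lra.
  by rewrite h3; lra.
(* Polarisation: three values of the form, each at most 1, bound [Q i j * l ^+ 2 / 2] by 3. *)
move=> i j.
have n2 : `|l / 2| = l / 2 by rewrite ger0_norm // divr_ge0 // ltW.
have d1 k : cube (l / 2) ((l / 2) *: (delta_mx 0 k : 'rV[R]_d)).
  by apply: cube_le (cubeZ (l / 2) (cube_delta k)); rewrite n2 mulr1.
have d2 k : cube l ((l / 2) *: (delta_mx 0 k : 'rV[R]_d)).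
  by apply: cube_le (d1 k); lra.
have d3 : cube l ((l / 2) *: (delta_mx 0 i : 'rV[R]_d) + (l / 2) *: delta_mx 0 j).
  by apply: cube_le (cubeD (d1 i) (d1 j)); lra.
have := qformD ((l / 2) *: delta_mx 0 i) ((l / 2) *: delta_mx 0 j) Qs.
have -> : ((l / 2) *: (delta_mx 0 i : 'rV[R]_d) *m Q *m ((l / 2) *: (delta_mx 0 j : 'rV[R]_d))^T) 0 0
    = (l / 2) ^+ 2 * Q i j.
  have tZ (s : R) (u : 'rV[R]_d) : (s *: u)^T = s *: u^T by rewrite linearZ.
  rewrite tZ -!scalemxAl -scalemxAr scalerA mxE -rowE trmx_delta -colE.
  by rewrite !mxE.
move: (qb _ (d2 i)) (qb _ (d2 j)) (qb _ d3).
set q1 := qform _ _; set q2 := qform _ _; set q3 := qform _ _.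
rewrite ler_pdivlMr ?exprn_gt0 // -[l ^+ 2]ger0_norm ?exprn_ge0 ?(ltW l0) // -normrM.
have -> : (l / 2) ^+ 2 * Q i j = Q i j * l ^+ 2 / 4 by field.
rewrite !ler_norml => /andP[? ?] /andP[? ?] /andP[? ?] ?.
by apply/andP; split; lra.
Qed.

Lemma near_const_ge0 : 0 <= @near_const R d.
Proof.
have q0 := @quad_const_ge0 R d; have d0 : 0 <= d%:R :> R by [].
apply: mulr_ge0; first by rewrite /core_const; lra.
by rewrite divr_ge0 // exprn_ge0 // ltW // level_gt0.
Qed.

Variables (f g : 'rV[R]_d -> complex R) (eps : R).
Hypothesis H : cf_pair f g eps.
Hypothesis eps_thr : eps <= @near_threshold R d.
Hypothesis eps_small : (@near_const R d + 4) * eps <= 1 / 40.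

Let eps0 : 0 <= eps.
Proof. by apply: le_trans (cf_eq H 0 0); rewrite cmod_ge0. Qed.

Let K := @near_const R d.
Let K0 : 0 <= K. Proof. exact: near_const_ge0. Qed.
Let Ke0 : 0 <= K * eps. Proof. exact: mulr_ge0. Qed.
Let Ke : K * eps <= 1 / 40.
Proof. by have := eps_small; rewrite -/K; have := eps0; nra. Qed.

Lemma near_gauss : exists (m1 m2 : 'rV[R]_d) (Q : 'M[R]_d), Q^T = Q /\
  forall x, near_region f g x ->
    cmod (f x - gauss_cf m1 Q x) <= K * eps /\
    cmod (g x - gauss_cf m2 Q x) <= K * eps.
Proof.
have /choice [p hp] : forall n : nat, exists p : 'rV[R]_d * 'rV[R]_d * 'M[R]_d,
    p.2^T = p.2 /\ forall x, near_region f g x -> cube n.+1%:R x ->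
      cmod (f x - gauss_cf p.1.1 p.2 x) <= K * eps /\
      cmod (g x - gauss_cf p.1.2 p.2 x) <= K * eps.
  move=> n; have [m1 [m2 [Q h]]] := near_gauss_box H (ltr0Sn R n) eps_thr.
  by exists (m1, m2, Q).
have [l1 l10 hl1] := near_region_cubeP H.
have [l2 l20 hl2] := cf_near0 H (ltac:(lra) : 0 < 1 / 8 :> R).
(* Since [l <= 1], this cube lies in every box, and there each fit is within 1/40 + 1/8 of 1. *)
pose l := Num.min (Num.min l1 l2) 1.
have l0 : 0 < l by rewrite /l !lt_min l10 l20 ltr01.
have bnd n : (forall x, cube l x -> cmod (gauss_cf (p n).1.1 (p n).2 x - 1) <= 1 / 4) /\
    (forall x, cube l x -> cmod (gauss_cf (p n).1.2 (p n).2 x - 1) <= 1 / 4).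
  have [_ hpn] := hp n.
  have hh x : cube l x -> [/\ near_region f g x, cube n.+1%:R x & cube l2 x].
    move=> xl; split; [apply: hl1| |]; apply: cube_le xl;
      rewrite /l !ge_min ?lexx ?orbT //.
    by rewrite -(natr1 n) lerDr ler0n !orbT.
  split=> x /hh[xn xb /hl2[h1 h2]]; have [h3 h4] := hpn x xn xb.
    have := cmod_dist_le (gauss_cf (p n).1.1 (p n).2 x) (f x) 1.
    by rewrite (cmodB _ (f x)); have := Ke; lra.
  have := cmod_dist_le (gauss_cf (p n).1.2 (p n).2 x) (g x) 1.
  by rewrite (cmodB _ (g x)); have := Ke; lra.
have [U [UU sU]] := ultraFilterLemma (F := \oo) _.
have PU : ProperFilter U by exact: ultra_proper.
have b1 n := gauss_near1_bounds l0 (hp n).1 (bnd n).1.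
have b2 n := gauss_near1_bounds l0 (hp n).1 (bnd n).2.
have /choice [m1 hm1] i := ultra_bounded_cvg UU (fun n => (b1 n).1 i).
have /choice [m2 hm2] i := ultra_bounded_cvg UU (fun n => (b2 n).1 i).
have /choice [Q hQ] ij := ultra_bounded_cvg UU (fun n => (b1 n).2 ij.1 ij.2).
exists (\row_i m1 i), (\row_i m2 i), (\matrix_(i, j) Q (i, j)).
have hQ' i j : (p n).2 i j @[n --> U] --> ((\matrix_(i, j) Q (i, j)) i j : R).
  by rewrite mxE; exact: (hQ (i, j)).
split.
  apply/matrixP => i j; rewrite [LHS]mxE.
  have e : (fun n => (p n).2 i j) = (fun n => (p n).2 j i).
    by apply/funext => n; rewrite -[in LHS](hp n).1 mxE.
  have h1 := hQ' i j; rewrite e in h1.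
  exact: (norm_cvg_unique (hQ' j i) h1).
move=> x nx.
have [N hN] : exists N : nat, cube N%:R x.
  exists (Num.truncn (\sum_i `|x 0 i|)).+1 => i.
  apply: le_trans (_ : \sum_i `|x 0 i| <= _); last first.
    by rewrite ltW // truncnS_gt // sumr_ge0.
  by rewrite (bigD1 i) //= lerDl sumr_ge0.
have ev : \forall n \near U, cube n.+1%:R x.
  apply: sU; exists N => // n /= Nn; apply: cube_le hN.
  by rewrite ler_nat; exact: leqW.
split; (apply: gauss_limit; [exact: PU|exact: Ke0| |exact: hQ'|]).
- by move=> i; rewrite mxE; exact: hm1.
- by apply: filterS ev => n /((hp n).2 x nx)[].
- by move=> i; rewrite mxE; exact: hm2.
- by apply: filterS ev => n /((hp n).2 x nx)[].
Qed.

Lemma near_region_star x s : 0 <= s <= 1 -> near_region f g x -> near_region f g (s *: x).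
Proof.
move=> /andP[s0 s1] nx t /andP[t0 t1]; rewrite scalerA; apply: nx.
by rewrite mulr_ge0 //= mulr_ile1.
Qed.

(** Better than [above_add]: on the diagonal the other factor is exactly 1, and the loss is a fourth
    power and [eps] only. *)
Lemma above_double y r : 0 <= r -> r <= cmod (f y) -> r <= cmod (g y) ->
  above f g (r ^+ 4 - eps) (y + y).
Proof.
move=> r0 fy gy.
have h : r ^+ 4 <= cmod (f y) * cmod (g y) * (cmod (f y) * cmod (g y)).
  rewrite (_ : r ^+ 4 = r * r * (r * r)); last by ring.
  by apply: ler_pM; rewrite ?mulr_ge0 //; apply: ler_pM.
split.
  have := cf_eq H y y; rewrite subrr (cf_g0 H) mulr1.
  have := cmod_lerB (f y * g y * (f y * g (- y))) (f (y + y)).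
  by rewrite cmodB !cmodM (cf_gN H) cmod_conjc; lra.
have := cf_eq H y (- y); rewrite subrr opprK (cf_f0 H) mul1r.
have := cmod_lerB (f y * g y * (f (- y) * g y)) (g (y + y)).
by rewrite cmodB !cmodM (cf_fN H) cmod_conjc; lra.
Qed.

Section Extension.
Variables (m1 m2 : 'rV[R]_d) (Q : 'M[R]_d).
Hypothesis near_approx : forall x, near_region f g x ->
    cmod (f x - gauss_cf m1 Q x) <= K * eps /\
    cmod (g x - gauss_cf m2 Q x) <= K * eps.

Let near_mod x : near_region f g x ->
  gauss_mod Q x - 1 / 40 <= cmod (f x) <= gauss_mod Q x + 1 / 40 /\
  gauss_mod Q x - 1 / 40 <= cmod (g x) <= gauss_mod Q x + 1 / 40.
Proof.
move=> /near_approx[h1 h2].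
have := le_trans (cmod_dist_norm _ _) h1; have := le_trans (cmod_dist_norm _ _) h2.
rewrite !cmod_gauss !ler_norml => /andP[? ?] /andP[? ?]; have := Ke.
by move=> ?; split; apply/andP; split; lra.
Qed.

Let eps_le : eps <= 1 / 160.
Proof. by have := eps_small; have := Ke0; rewrite /K; lra. Qed.

(** Here 1/32 is calibrated: the moduli are at least 1/2 - 1/40 = 19/40 on the segment, and
    (19/40)^4 - 1/160 exceeds 1/32. *)
Let double_in x : near_region f g x ->
  (forall s, 0 <= s <= 1 -> 1 / 2 <= gauss_mod Q (s *: x)) -> near_region f g (x + x).
Proof.
move=> nx hx s s01; rewrite scalerDr.
have [/andP[h1 _] /andP[h2 _]] := near_mod (near_region_star s01 nx).
have h3 := hx s s01.
have r0 : (0 : R) <= 19 / 40 by lra.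
have fy : 19 / 40 <= cmod (f (s *: x)) by lra.
have gy : 19 / 40 <= cmod (g (s *: x)) by lra.
apply: above_le (above_double r0 fy gy).
by have := eps_le; lra.
Qed.

Lemma near_scale_exists x : exists n : nat, near_region f g (2^-1 ^+ n *: x).
Proof.
have [l l0 hl] := near_region_cubeP H.
pose B := \sum_i `|x 0 i|.
have B0 : 0 <= B by apply: sumr_ge0.
exists (Num.truncn (B / l)).+1; apply: hl => i.
have h : B / l < (Num.truncn (B / l)).+1%:R by rewrite truncnS_gt ?divr_ge0 // ltW.
set n := (Num.truncn _).+1 in h *.
rewrite mxE normrM ger0_norm ?exprn_ge0 ?invr_ge0 // exprVn mulrC.
rewrite ler_pdivrMr ?exprn_gt0 //; rewrite ltr_pdivrMr // in h.
apply: le_trans (_ : B <= _); first by rewrite /B (bigD1 i) //= lerDl sumr_ge0.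
apply: (le_trans (ltW h)); rewrite mulrC ler_wpM2l ?(ltW l0) //.
by rewrite -natrX ler_nat ltnW // ltn_expl.
Qed.

(* If the form were negative at x, doubling would never leave the near region,
   where gauss_mod is at most 1 + 1/40, although it is unbounded along the ray. *)
Lemma near_gauss_psd x : 0 <= qform Q x.
Proof.
rewrite leNgt; apply/negP => qx.
have [n0 hn0] := near_scale_exists x; set y := _ *: x in hn0.
have qy : qform Q y < 0.
  by rewrite /y qformZ pmulr_rlt0 // !exprn_gt0 // invr_gt0.
have all_near n : near_region f g (2 ^+ n *: y).
  elim: n => [|n IH]; first by rewrite expr0 scale1r.
  have -> : 2 ^+ n.+1 *: y = 2 ^+ n *: y + 2 ^+ n *: y.
    by rewrite -scalerDl exprS mulr_natl mulr2n.
  apply: double_in => // s _; rewrite scalerA.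
  apply: le_trans (_ : 1 <= _); first by lra.
  rewrite /gauss_mod qformZ.
  have h1 := expR_ge1Dx (- (1 / 2) * ((s * 2 ^+ n) ^+ 2 * qform Q y)).
  have h2 : 0 <= (s * 2 ^+ n) ^+ 2 by exact: sqr_ge0.
  by nra.
have : - qform Q y <= 0.
  apply: (@le_of_le_addexp _ _ _ 2) => n; rewrite add0r ler_pdivlMr ?exprn_gt0 //.
  have [/andP[h1 _] _] := near_mod (all_near n); have h2 := cf_f1 H (2 ^+ n *: y).
  have h3 := expR_ge1Dx (- (1 / 2) * qform Q (2 ^+ n *: y)).
  rewrite /gauss_mod in h1; rewrite qformZ in h1 h3.
  have h4 : 1 <= 2 ^+ n :> R by rewrite exprn_ege1 // ler1n.
  have h5 : - qform Q y * 2 ^+ n <= - qform Q y * (2 ^+ n) ^+ 2.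
    by rewrite ler_wpM2l ?ler_eXnr //; lra.
  have := h1; have := h3; have := h5; lra.
by lra.
Qed.

(** The added 4 gives [4 * eps <= K2 * eps], so that the defect of the equation fits into the margin
    left by the contraction. *)
Let K2 := K + 4.

Let prod_dist (P D : R) (z1 z2 w1 w2 : complex R) : 0 <= P ->
  cmod z1 <= P -> cmod w2 <= P -> cmod (z1 - w1) <= D -> cmod (z2 - w2) <= D ->
  cmod (z1 * z2 - w1 * w2) <= 2 * P * D.
Proof.
move=> P0 h1 h2 h3 h4.
have -> : z1 * z2 - w1 * w2 = z1 * (z2 - w2) + (z1 - w1) * w2.
  by rewrite mulrBr mulrBl addrA subrK.
apply: le_trans (cmodD _ _) _; rewrite !cmodM.
have := ler_pM (cmod_ge0 _) (cmod_ge0 _) h1 h4.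
have := ler_pM (cmod_ge0 _) (cmod_ge0 _) h3 h2.
by lra.
Qed.

Lemma double_error (F G : 'rV[R]_d -> complex R) (k1 k2 : 'rV[R]_d) y :
  cf_pair F G eps -> gauss_mod Q y <= 1 / 2 ->
  cmod (F y - gauss_cf k1 Q y) <= K2 * eps ->
  cmod (G y - gauss_cf k2 Q y) <= K2 * eps ->
  cmod (F (y + y) - gauss_cf k1 Q (y + y)) <= K2 * eps.
Proof.
move=> HF g2 hF hG; have De : K2 * eps <= 1 / 40 by exact: eps_small.
have D0 : 0 <= K2 * eps by apply: le_trans hF; exact: cmod_ge0.
rewrite (gauss_cf_double k1 k2).
have hG' : cmod (G (- y) - gauss_cf k2 Q (- y)) <= K2 * eps.
  by rewrite (cf_gN HF) gauss_cf_opp -rmorphB /= cmod_conjc.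
(* All factors are at most P = 1/2 + 1/40. Comparing the fourfold products multiplies the error D by
   4 P^3 < 0.58, and the defect [eps] adds at most D / 4, which leaves a total below D. *)
set P : R := 21 / 40; set D := K2 * eps in De D0 hF hG hG' *.
have P0 : 0 <= P by rewrite /P; lra.
have w1 : cmod (gauss_cf k1 Q y) <= P by rewrite cmod_gauss /P; lra.
have w2 : cmod (gauss_cf k2 Q y) <= P by rewrite cmod_gauss /P; lra.
have w2' : cmod (gauss_cf k2 Q (- y)) <= P by rewrite gauss_cf_opp cmod_conjc.
have zF : cmod (F y) <= P.
  have := cmod_lerB (F y) (gauss_cf k1 Q y); rewrite cmod_gauss /P; lra.
have zG : cmod (G y) <= P.
  have := cmod_lerB (G y) (gauss_cf k2 Q y); rewrite cmod_gauss /P; lra.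
have e1 := prod_dist P0 zF w2 hF hG.
have e2 := prod_dist P0 zF w2' hF hG'.
have P2 : 0 <= P ^+ 2 by exact: sqr_ge0.
have zFG : cmod (F y * G y) <= P ^+ 2.
  by rewrite cmodM expr2; apply: ler_pM => //; exact: cmod_ge0.
have wFG : cmod (gauss_cf k1 Q y * gauss_cf k2 Q (- y)) <= P ^+ 2.
  by rewrite cmodM expr2; apply: ler_pM => //; exact: cmod_ge0.
have e3 := prod_dist P2 zFG wFG e1 e2.
have e4 := cf_eq HF y y; rewrite subrr (cf_g0 HF) mulr1 in e4.
apply: le_trans (cmod_dist_le _ _ _) _; apply: le_trans (lerD e4 e3) _.
have : 4 * eps <= D by have := Ke0; rewrite /D /K2; lra.
by rewrite /P; lra.
Qed.

Lemma gauss_extension x :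
  cmod (f x - gauss_cf m1 Q x) <= K2 * eps /\ cmod (g x - gauss_cf m2 Q x) <= K2 * eps.
Proof.
pose good y := cmod (f y - gauss_cf m1 Q y) <= K2 * eps /\
  cmod (g y - gauss_cf m2 Q y) <= K2 * eps.
have near_good y : near_region f g y -> good y.
  move=> /near_approx[h1 h2]; have := eps0 => ?.
  by split; rewrite /K2; lra.
have good_double y : good y -> gauss_mod Q y <= 1 / 2 ->
    good (y + y) /\ gauss_mod Q (y + y) <= 1 / 2.
  move=> [h1 h2] h3; split.
    split; first exact: double_error H h3 h1 h2.
    exact: double_error (cf_pair_swap H) h3 h2 h1.
  rewrite gauss_mod_double; apply: (le_trans _ h3).
  have g0 : 0 <= gauss_mod Q y by exact: expR_ge0.
  by rewrite ler_iXnr //; lra.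
have [n] := near_scale_exists x.
(* Along the dyadic orbit of a near point, either the point is still near, or the estimate holds and
   the Gaussian modulus is at most 1/2. The second alternative persists, as doubling raises the
   modulus to the fourth power. *)
suff : forall k, near_region f g (2^-1 ^+ n *: x) ->
    near_region f g (2 ^+ k *: (2^-1 ^+ n *: x)) \/
    (good (2 ^+ k *: (2^-1 ^+ n *: x)) /\
     gauss_mod Q (2 ^+ k *: (2^-1 ^+ n *: x)) <= 1 / 2).
  move=> /(_ n) h /h; rewrite scalerA -exprMn divff // expr1n scale1r.
  by case=> [/near_good|[]].
move=> k; set y := 2^-1 ^+ n *: x => ny.
elim: k => [|k IH]; first by left; rewrite expr0 scale1r.
have -> : 2 ^+ k.+1 *: y = 2 ^+ k *: y + 2 ^+ k *: y.
  by rewrite -scalerDl exprS mulr_natl mulr2n.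
set z := 2 ^+ k *: y in IH *.
case: IH => [nz|[gz hz]]; last by right; exact: good_double.
have [nzz|nzz] := pselect (near_region f g (z + z)); first by left.
right; apply: good_double; first exact: near_good.
(* A modulus above 1/2 at [z] would be above 1/2 on the whole segment from 0, the form being
   nonnegative, and then [z + z] would be near. *)
rewrite leNgt; apply/negP => hz; apply: nzz; apply: double_in => // s /andP[s0 s1].
apply: (le_trans (ltW hz)); rewrite ler_expR (qformZ Q s z).
have s2 : s ^+ 2 <= 1 by rewrite exprn_ile1.
have := ler_wpM2r (near_gauss_psd z) s2; lra.
Qed.

End Extension.

Theorem cf_pair_stability : exists (m1 m2 : 'rV[R]_d) (Q : 'M[R]_d), sym_psd Q /\
  forall x, cmod (f x - gauss_cf m1 Q x) <= (@near_const R d + 4) * eps /\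
    cmod (g x - gauss_cf m2 Q x) <= (@near_const R d + 4) * eps.
Proof.
have [m1 [m2 [Q [Qs h]]]] := near_gauss; exists m1, m2, Q; split.
  by split=> // v; exact: near_gauss_psd h v.
by move=> x; exact: gauss_extension h x.
Qed.

End NearGauss.

(** * Characteristic functions *)

Section BoundedExpectation.
Context {dT : measure_display} {T : measurableType dT} {R : realType}.
Variable P : probability T R.
Implicit Types h k : T -> R.

Definition bounded_mfun h :=
  measurable_fun setT h /\ exists M, forall x, `|h x| <= M.

Lemma bounded_mfun_integrable h : bounded_mfun h -> P.-integrable setT (EFin \o h).
Proof.
move=> [mh [M hM]]; apply: measurable_bounded_integrable => //.
  by rewrite (le_lt_trans (probability_le1 P measurableT)) ?ltry.
exists M; split; first exact: num_real.
by move=> N MN x _; apply: le_trans (hM x) (ltW MN).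
Qed.

Lemma expectRE h : expectR P h = Rintegral P setT h.
Proof. by []. Qed.

Lemma expectRD h k : bounded_mfun h -> bounded_mfun k ->
  expectR P (fun x => h x + k x) = expectR P h + expectR P k.
Proof. by move=> bh bk; apply: RintegralD => //; exact: bounded_mfun_integrable. Qed.

Lemma expectRZ a h : bounded_mfun h -> expectR P (fun x => a * h x) = a * expectR P h.
Proof. by move=> bh; apply: RintegralZl => //; exact: bounded_mfun_integrable. Qed.

Lemma expectR_cst a : expectR P (fun=> a) = a.
Proof.
rewrite expectRE Rintegral_cst //.
rewrite -[RHS]mulr1; congr (_ * _).
by rewrite -[RHS]/(fine 1%E); congr fine; exact: probability_setT.
Qed.

Lemma le_expectR h k : bounded_mfun h -> bounded_mfun k -> (forall x, h x <= k x) ->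
  expectR P h <= expectR P k.
Proof. by move=> bh bk hk; apply: le_Rintegral => //; exact: bounded_mfun_integrable. Qed.

Lemma bounded_mfun_cst a : bounded_mfun (fun=> a).
Proof. by split; [exact: measurable_cst | exists `|a|]. Qed.

Lemma bounded_mfunD h k : bounded_mfun h -> bounded_mfun k ->
  bounded_mfun (fun x => h x + k x).
Proof.
move=> [mh [M hM]] [mk [N kN]]; split; first exact: measurable_funD.
by exists (M + N) => x; rewrite (le_trans (ler_normD _ _)) // lerD.
Qed.

Lemma bounded_mfunM h k : bounded_mfun h -> bounded_mfun k ->
  bounded_mfun (fun x => h x * k x).
Proof.
move=> [mh [M hM]] [mk [N kN]]; split; first exact: measurable_funM.
by exists (M * N) => x; rewrite normrM; apply: ler_pM.
Qed.

Lemma bounded_mfunZ a h : bounded_mfun h -> bounded_mfun (fun x => a * h x).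
Proof. exact: bounded_mfunM (bounded_mfun_cst a). Qed.

Lemma bounded_mfun_cos h : measurable_fun setT h -> bounded_mfun (fun x => cos (h x)).
Proof.
move=> mh; split; last by exists 1 => x; exact: cos_max.
apply: (measurableT_comp _ mh); apply: continuous_measurable_fun.
exact: continuous_cos.
Qed.

Lemma bounded_mfun_sin h : measurable_fun setT h -> bounded_mfun (fun x => sin (h x)).
Proof.
move=> mh; split; last by exists 1 => x; exact: sin_max.
apply: (measurableT_comp _ mh); apply: continuous_measurable_fun.
exact: continuous_sin.
Qed.

Lemma norm_expectR_le h k : bounded_mfun h -> bounded_mfun k ->
  (forall x, `|h x| <= k x) -> `|expectR P h| <= expectR P k.
Proof.
move=> bh bk hk; rewrite ler_norml; apply/andP; split.
  rewrite -mulN1r -expectRZ //; apply: le_expectR => //; first exact: bounded_mfunZ.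
  by move=> x; rewrite mulN1r; have := hk x; rewrite ler_norml => /andP[].
by apply: le_expectR => // x; have := hk x; rewrite ler_norml => /andP[].
Qed.

Lemma cf_phase_le1 h : measurable_fun setT h -> cmod (cf_phase P h) <= 1.
Proof.
move=> mh; rewrite /cf_phase; set a := expectR P _; set b := expectR P _.
have bc := bounded_mfun_cos mh; have bs := bounded_mfun_sin mh.
rewrite cmod_le_sqr // expr1n.
(* With a, b the real and imaginary parts of the expectation, the left side is a^2 + b^2, and the
   pointwise inequality bounds it by (1 + a^2 + b^2) / 2. *)
have : expectR P (fun x => a * cos (h x) + b * sin (h x)) <=
    expectR P (fun=> (1 + a ^+ 2 + b ^+ 2) / 2).
  apply: le_expectR; first by apply: bounded_mfunD; exact: bounded_mfunZ.
    exact: bounded_mfun_cst.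
  move=> x; have := cos2Dsin2 (h x).
  have := sqr_ge0 (a - cos (h x)); have := sqr_ge0 (b - sin (h x)).
  by rewrite !sqrrB; lra.
rewrite expectRD; try exact: bounded_mfunZ.
rewrite expectR_cst !expectRZ // -/a -/b; lra.
Qed.

Lemma cf_phase0 : cf_phase P (fun=> 0) = 1.
Proof.
congr Complex.
  by rewrite -[RHS](expectR_cst 1); congr expectR; apply/funext => x; exact: cos0.
by rewrite -[RHS](expectR_cst 0); congr expectR; apply/funext => x; exact: sin0.
Qed.

Lemma cf_phaseN h : measurable_fun setT h ->
  cf_phase P (fun x => - h x) = conjc (cf_phase P h).
Proof.
move=> mh; rewrite /cf_phase /=; congr Complex.
  by congr expectR; apply/funext => x; rewrite cosN.
rewrite -mulN1r -expectRZ; last exact: bounded_mfun_sin.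
by congr expectR; apply/funext => x; rewrite sinN mulN1r.
Qed.

Lemma cf_phase_dist1 h k : measurable_fun setT h -> bounded_mfun k ->
  (forall x, circ (h x) <= k x) -> cmod (cf_phase P h - 1) <= 2 * expectR P k.
Proof.
move=> mh bk hk.
have bc := bounded_mfun_cos mh; have bs := bounded_mfun_sin mh.
have -> : cf_phase P h - 1 =
    Complex (expectR P (fun x => cos (h x) + -1)) (expectR P (fun x => sin (h x))).
  rewrite expectRD //; last exact: bounded_mfun_cst.
  by rewrite expectR_cst /cf_phase; congr Complex; rewrite /= subr0.
have cis1 x : cis (h x) - 1 = Complex (cos (h x) - 1) (sin (h x)).
  by rewrite /cis; congr Complex; rewrite /= subr0.
set a := expectR P _; set b := expectR P _.
have ha : `|a| <= expectR P k.
  apply: norm_expectR_le => //.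
    by apply: bounded_mfunD => //; exact: bounded_mfun_cst.
  move=> x; apply: le_trans (hk x); rewrite /circ cis1; exact: ge_cmod_Re.
have hb : `|b| <= expectR P k.
  apply: norm_expectR_le => // x; apply: le_trans (hk x).
  by rewrite /circ cis1; exact: ge_cmod_Im.
have -> : Complex a b = Complex a 0 + Complex 0 b.
  by congr Complex; rewrite /= ?addr0 ?add0r.
apply: le_trans (cmodD _ _) _; rewrite cmod_real cmod_def expr0n add0r sqrtr_sqr.
lra.
Qed.

End BoundedExpectation.

(** * Factorisation of expectations under independence *)

Section IndependentProduct.
Context {dT : measure_display} {T : measurableType dT} {R : realType}.
Variables (P : probability T R) (U V : T -> R).
Hypotheses (mU : measurable_fun setT U) (mV : measurable_fun setT V).
Hypothesis indepUV : forall A B : set R, measurable A -> measurable B ->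
  P (U @^-1` A `&` V @^-1` B) = (P (U @^-1` A) * P (V @^-1` B))%E.

Lemma ge0_integral_indep (phi psi : R -> R) :
  measurable_fun setT phi -> measurable_fun setT psi ->
  (forall x, 0 <= phi x) -> (forall x, 0 <= psi x) ->
  (\int[P]_x (phi (U x) * psi (V x))%:E =
   \int[P]_x (phi (U x))%:E * \int[P]_x (psi (V x))%:E)%E.
Proof.
move=> mphi mpsi phi0 psi0.
pose W x := (U x, V x).
have mW : measurable_fun setT W by exact: measurable_fun_pair.
pose U' : {mfun T >-> R} := HB.pack U (isMeasurableFun.Build _ _ _ _ _ mU).
pose V' : {mfun T >-> R} := HB.pack V (isMeasurableFun.Build _ _ _ _ _ mV).
pose W' : {mfun T >-> (R * R)%type} :=
  HB.pack W (isMeasurableFun.Build _ _ _ _ _ mW).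
pose pU := distribution P U'; pose pV := distribution P V'.
pose F (z : R * R) := (phi z.1 * psi z.2)%:E.
have mF : measurable_fun setT F.
  apply/measurable_EFinP; apply: measurable_funM.
    by apply: measurableT_comp.
  by apply: measurableT_comp.
have F0 z : (0 <= F z)%E by rewrite lee_fin mulr_ge0.
have -> : (\int[P]_x (phi (U x) * psi (V x))%:E =
    \int[distribution P W']_z F z)%E.
  by rewrite ge0_integral_distribution.
(* Independence says that the joint law agrees with the product of the marginal laws on rectangles,
   which determine a product measure. *)
rewrite (eq_measure_integral (pU \x pV)%E); last first.
  by move=> A mA _; apply/esym; apply: product_measure_unique.
rewrite fubini_tonelli1 //.
have -> : (\int[P]_x (psi (V x))%:E = \int[pV]_y (psi y)%:E)%E.
  by rewrite ge0_integral_distribution //; exact/measurable_EFinP.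
have -> : (\int[P]_x (phi (U x))%:E = \int[pU]_y (phi y)%:E)%E.
  by rewrite ge0_integral_distribution //; exact/measurable_EFinP.
rewrite -ge0_integralZr //; last 3 first.
- exact/measurable_EFinP.
- by move=> x _; rewrite lee_fin.
- by apply: integral_ge0 => y _; rewrite lee_fin.
apply: eq_integral => x _; rewrite /fubini_F.
rewrite -ge0_integralZl //; last 3 first.
- exact/measurable_EFinP.
- by move=> y _; rewrite lee_fin.
- by rewrite lee_fin.
Qed.

Lemma expectR_indep (phi psi : R -> R) :
  measurable_fun setT phi -> measurable_fun setT psi ->
  (forall x, `|phi x| <= 1) -> (forall x, `|psi x| <= 1) ->
  expectR P (fun x => phi (U x) * psi (V x)) =
  expectR P (phi \o U) * expectR P (psi \o V).
Proof.
move=> mphi mpsi phi1 psi1.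
have bphi : bounded_mfun (phi \o U).
  by split; [exact: measurableT_comp | exists 1 => x /=].
have bpsi : bounded_mfun (psi \o V).
  by split; [exact: measurableT_comp | exists 1 => x /=].
have b1 : bounded_mfun (fun _ : T => 1 : R) by exact: bounded_mfun_cst.
have m1 : measurable_fun setT (fun _ : R => 1 : R) by exact: measurable_cst.
have h1 x : 0 <= phi x + 1 by have := phi1 x; rewrite ler_norml => /andP[]; lra.
have h2 x : 0 <= psi x + 1 by have := psi1 x; rewrite ler_norml => /andP[]; lra.
(* Adding 1 makes both functions nonnegative, so that the Tonelli version applies; expanding the
   product and cancelling the linear terms gives the claim. *)
have := ge0_integral_indep (measurable_funD mphi m1) (measurable_funD mpsi m1) h1 h2.
move=> /(congr1 fine); rewrite fineM; last 2 first.
- apply: integrable_fin_num => //.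
  by apply: (@bounded_mfun_integrable _ _ _ _ (fun x => phi (U x) + 1)); exact: bounded_mfunD.
- apply: integrable_fin_num => //.
  by apply: (@bounded_mfun_integrable _ _ _ _ (fun x => psi (V x) + 1)); exact: bounded_mfunD.
rewrite -[LHS]/(expectR P (fun x => (phi (U x) + 1) * (psi (V x) + 1))).
rewrite -[X in _ = X * _]/(expectR P (fun x => phi (U x) + 1)).
rewrite -[X in _ = _ * X]/(expectR P (fun x => psi (V x) + 1)).
have -> : (fun x => (phi (U x) + 1) * (psi (V x) + 1)) =
  (fun x => phi (U x) * psi (V x) + (phi (U x) + (psi (V x) + 1))).
  by apply/funext => x; ring.
have bpsi1 : bounded_mfun (fun x => psi (V x) + 1) by exact: bounded_mfunD.
have bsum : bounded_mfun (fun x => phi (U x) + (psi (V x) + 1)).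
  exact: bounded_mfunD.
have bprod : bounded_mfun (fun x => phi (U x) * psi (V x)) by exact: bounded_mfunM.
rewrite (expectRD P bprod bsum) (expectRD P bphi bpsi1) (expectRD P bphi b1).
rewrite (expectRD P bpsi b1) expectR_cst; lra.
Qed.

Lemma cf_phase_indep :
  cf_phase P (fun x => U x + V x) = cf_phase P U * cf_phase P V.
Proof.
have mcos : measurable_fun setT (@cos R).
  by apply: continuous_measurable_fun; exact: continuous_cos.
have msin : measurable_fun setT (@sin R).
  by apply: continuous_measurable_fun; exact: continuous_sin.
have bcU := bounded_mfun_cos mU; have bsU := bounded_mfun_sin mU.
have bcV := bounded_mfun_cos mV; have bsV := bounded_mfun_sin mV.
rewrite /cf_phase; apply/eqP; rewrite eq_complex /=; apply/andP; split; apply/eqP.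
  have -> : (fun x => cos (U x + V x)) =
     (fun x => cos (U x) * cos (V x) + -1 * (sin (U x) * sin (V x))).
    by apply/funext => x; rewrite cosD mulN1r.
  rewrite expectRD ?expectRZ //; try exact: bounded_mfunM.
    rewrite mulN1r (expectR_indep mcos mcos (@cos_max R) (@cos_max R)).
    by rewrite (expectR_indep msin msin (@sin_max R) (@sin_max R)).
  by apply: bounded_mfunZ; exact: bounded_mfunM.
have -> : (fun x => sin (U x + V x)) =
   (fun x => cos (U x) * sin (V x) + sin (U x) * cos (V x)).
  by apply/funext => x; rewrite sinD addrC.
rewrite expectRD //; try exact: bounded_mfunM.
rewrite (expectR_indep mcos msin (@cos_max R) (@sin_max R)).
by rewrite (expectR_indep msin mcos (@sin_max R) (@cos_max R)).
Qed.

End IndependentProduct.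

Section CharfunPair.
Context {dT : measure_display} {T : measurableType dT} {R : realType} {d : nat}.
Variable P : probability T R.
Implicit Types X Y : T -> 'rV[R]_d.

Lemma measurable_dotv X t : random_vector X ->
  measurable_fun setT (fun x => dotv t (X x)).
Proof.
move=> mX; apply: measurable_sum => i.
by apply: measurable_funM; [exact: measurable_cst | exact: mX].
Qed.

Lemma sigma_of_dotv X t (A : set R) : measurable A ->
  sigma_of X ((fun x => dotv t (X x)) @^-1` A).
Proof.
move=> mA; pose G := [set E | exists (i : 'I_d) (B : set R),
  measurable B /\ E = (fun x => X x 0 i) @^-1` B].
(* On [T'], the same set with the sigma-algebra generated by the coordinates of [X], measurability
   of [dotv t X] is precisely membership in [sigma_of X]. *)
pose T' := g_sigma_algebraType G.
have mX i : measurable_fun setT (fun x : T' => X x 0 i).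
  move=> _ B mB; rewrite setTI; apply: sub_sigma_algebra.
  by exists i, B.
have mt : measurable_fun setT (fun x : T' => dotv t (X x)).
  apply: measurable_sum => i.
  by apply: measurable_funM; [exact: measurable_cst | exact: mX].
by have := mt measurableT _ mA; rewrite setTI.
Qed.

Lemma charfun_indep X1 X2 s t : random_vector X1 -> random_vector X2 ->
  independent P X1 X2 ->
  cf_phase P (fun x => dotv s (X1 x) + dotv t (X2 x)) = charfun P X1 s * charfun P X2 t.
Proof.
move=> m1 m2 ind; apply: cf_phase_indep; try exact: measurable_dotv.
by move=> A B mA mB; apply: ind; exact: sigma_of_dotv.
Qed.

(** No moment of [X] is assumed finite, so |cis (dotv t X) - 1| is dominated by the truncation
    [g n], whose expectation tends to 0 by dominated convergence. *)
Lemma charfun_near0 X e : random_vector X -> 0 < e ->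
  exists2 l, 0 < l & forall t, cube l t -> cmod (charfun P X t - 1) <= e.
Proof.
move=> mX e0; pose N x := norm1 (X x).
have mN : measurable_fun setT N.
  apply: measurable_sum => i; apply: measurableT_comp; last exact: mX.
  exact: normr_measurable.
have N0 x : 0 <= N x by apply: sumr_ge0.
pose g (n : nat) x := Num.min (N x / n.+1%:R) 2.
have mg n : measurable_fun setT (g n).
  apply: measurable_minr; last exact: measurable_cst.
  by apply: measurable_funM => //; exact: measurable_cst.
have g0 n x : 0 <= g n x by rewrite le_min ler0n andbT divr_ge0.
have g2 n x : g n x <= 2 by rewrite ge_min lexx orbT.
have bg n : bounded_mfun (g n).
  by split=> //; exists 2 => x; rewrite ger0_norm.
have lim0 : (fun n => expectR P (g n)) @ \oo --> (0 : R).
  have h1 n : measurable_fun setT (EFin \o g n) by exact/measurable_EFinP.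
  have h2 : {ae P, forall x, setT x -> (EFin \o g n) x @[n --> \oo] --> (cst 0%E : T -> \bar R) x}.
    apply: aeW => x _; apply: cvg_EFin; first by near=> n.
    have h : N x * n.+1%:R^-1 @[n --> \oo] --> N x * 0.
      by apply: cvgMl_tmp; exact: cvg_harmonic.
    rewrite mulr0 in h; apply: (squeeze_cvgr _ (cvg_cst 0) h).
    by apply: nearW => n /=; rewrite g0 /= ge_min lexx.
  have h3 : {ae P, forall x n, setT x -> (`|(EFin \o g n) x| <= (EFin \o cst (2%R : R)) x)%E}.
    by apply: aeW => x n _; rewrite /= lee_fin ger0_norm.
  have [_ _] := dominated_convergence measurableT h1 (measurable_cst _) h2
    (bounded_mfun_integrable P (bounded_mfun_cst 2)) h3.
  by rewrite integral0 => h; exact: fine_cvg h.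
have [n _ hn] : \forall n \near \oo, expectR P (g n) < e / 2.
  by apply: (cvgr_lt _ lim0); rewrite divr_gt0.
exists (n.+1%:R^-1); first by rewrite invr_gt0.
move=> t tl; apply: le_trans (cf_phase_dist1 P (measurable_dotv t mX) (bg n) _) _.
  move=> x; rewrite le_min; apply/andP; split.
    apply: le_trans (circ_le_norm _) _; apply: le_trans (ler_norm_sum _ _ _) _.
    rewrite /N /norm1 mulr_suml; apply: ler_sum => i _.
    by rewrite normrM mulrC ler_wpM2l.
  rewrite /circ; apply: le_trans (cmodD _ _) _.
  by rewrite cmod_cis cmodN cmod1; lra.
by have := hn n (leqnn n) => /=; lra.
Unshelve. all: by end_near.
Qed.

Lemma norm1_ge0 (t : 'rV[R]_d) : 0 <= norm1 t.
Proof. by apply: sumr_ge0. Qed.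

Lemma dotvDr (t u v : 'rV[R]_d) : dotv t (u + v) = dotv t u + dotv t v.
Proof. by rewrite /dotv -big_split; apply: eq_bigr => i _; rewrite mxE mulrDr. Qed.

Lemma dotvNr (t v : 'rV[R]_d) : dotv t (- v) = dotv (- t) v.
Proof. by apply: eq_bigr => i _; rewrite !mxE mulrN mulNr. Qed.

Lemma charfun_cf_pair X1 X2 eps : random_vector X1 -> random_vector X2 ->
  independent P X1 X2 ->
  eps_dependent P (fun x => X1 x + X2 x) (fun x => X1 x - X2 x) eps ->
  cf_pair (charfun P X1) (charfun P X2) eps.
Proof.
move=> m1 m2 ind dep.
have cf0 X : charfun P X 0 = 1.
  rewrite /charfun; have -> : (fun x => dotv 0 (X x)) = (fun=> 0).
    by apply/funext => x; rewrite /dotv big1 // => i _; rewrite mxE mul0r.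
  exact: cf_phase0.
have cfN X : random_vector X -> forall t, charfun P X (- t) = conjc (charfun P X t).
  move=> mX t; rewrite /charfun -cf_phaseN; last exact: measurable_dotv.
  by congr cf_phase; apply/funext => x; rewrite dotvNl.
split; rewrite ?cf0 //.
- by move=> t; apply: cf_phase_le1; exact: measurable_dotv.
- by move=> t; apply: cf_phase_le1; exact: measurable_dotv.
- exact: cfN.
- exact: cfN.
- move=> e e0; have [l1 l10 h1] := charfun_near0 m1 e0.
  have [l2 l20 h2] := charfun_near0 m2 e0.
  exists (Num.min l1 l2); first by rewrite lt_min l10 l20.
  by move=> t tl; split; [apply: h1 | apply: h2]; apply: cube_le tl;
    rewrite ge_min lexx ?orbT.
- move=> t1 t2.
  have := dep (norm1 t1 + norm1 t2) (addr_ge0 (norm1_ge0 _) (norm1_ge0 _)) t1 t2.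
  rewrite lerDl norm1_ge0 lerDr norm1_ge0 => /(_ isT isT).
  have -> : joint_charfun P (fun x => X1 x + X2 x) (fun x => X1 x - X2 x) t1 t2 =
      charfun P X1 (t1 + t2) * charfun P X2 (t1 - t2).
    rewrite -charfun_indep //; congr cf_phase; apply/funext => x.
    by rewrite !dotvDr !dotvDl dotvNr; ring.
  have -> : charfun P (fun x => X1 x + X2 x) t1 = charfun P X1 t1 * charfun P X2 t1.
    by rewrite -charfun_indep //; congr cf_phase; apply/funext => x; rewrite dotvDr.
  have -> // : charfun P (fun x => X1 x - X2 x) t2 = charfun P X1 t2 * charfun P X2 (- t2).
  rewrite -charfun_indep //; congr cf_phase; apply/funext => x.
  by rewrite dotvDr dotvNr.
Qed.

End CharfunPair.

Theorem theorem3 (R : realType) (d : nat) :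
  exists (eps0 C : R), 0 < eps0 /\
  (forall (dT : measure_display) (T : measurableType dT) (P : probability T R)
     (X1 X2 : T -> 'rV[R]_d),
     random_vector X1 -> random_vector X2 -> independent P X1 X2 ->
     forall eps : R, 0 <= eps -> eps < eps0 ->
     eps_dependent P (fun x => X1 x + X2 x) (fun x => X1 x - X2 x) eps ->
     exists (m1 m2 : 'rV[R]_d) (Q : 'M[R]_d), sym_psd Q /\
       forall t : 'rV[R]_d,
         cmod (charfun P X1 t - gauss_cf m1 Q t) <= C * eps /\
         cmod (charfun P X2 t - gauss_cf m2 Q t) <= C * eps) /\
  (forall (dT : measure_display) (T : measurableType dT) (P : probability T R)
     (X1 X2 : T -> 'rV[R]_d),
     random_vector X1 -> random_vector X2 -> independent P X1 X2 ->
     eps_dependent P (fun x => X1 x + X2 x) (fun x => X1 x - X2 x) 0 ->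
     exists (m1 m2 : 'rV[R]_d) (Q : 'M[R]_d), sym_psd Q /\
       forall t : 'rV[R]_d,
         charfun P X1 t = gauss_cf m1 Q t /\ charfun P X2 t = gauss_cf m2 Q t).
Proof.
pose C := @near_const R d + 4.
have C0 : 0 < C by rewrite /C; have := @near_const_ge0 R d; lra.
(* The first bound serves the fit in each box, the second is the condition [C * eps <= 1 / 40] under
   which doubling contracts the error. Both depend on [d] only and are fixed before the probability
   space. *)
pose eps0 := Num.min (@near_threshold R d) (1 / 40 / C).
have thr0 : 0 < @near_threshold R d.
  have := @quad_const_ge0 R d; have := @level_gt0 R (d + 2) => l0 q0.
  by rewrite /near_threshold divr_gt0 // mulr_gt0 ?exprn_gt0 //; lra.
have eps00 : 0 < eps0 by rewrite lt_min thr0 !divr_gt0.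
have main (dT : measure_display) (T : measurableType dT) (P : probability T R)
     (X1 X2 : T -> 'rV[R]_d) :
     random_vector X1 -> random_vector X2 -> independent P X1 X2 ->
     forall eps : R, eps < eps0 ->
     eps_dependent P (fun x => X1 x + X2 x) (fun x => X1 x - X2 x) eps ->
     exists (m1 m2 : 'rV[R]_d) (Q : 'M[R]_d), sym_psd Q /\
       forall t : 'rV[R]_d,
         cmod (charfun P X1 t - gauss_cf m1 Q t) <= C * eps /\
         cmod (charfun P X2 t - gauss_cf m2 Q t) <= C * eps.
  move=> rX1 rX2 ind eps; rewrite lt_min => /andP[e1 e2] dep.
  apply: (cf_pair_stability (charfun_cf_pair rX1 rX2 ind dep) (ltW e1)).
  by rewrite mulrC -ler_pdivlMr // ltW.
exists eps0, C; split=> //; split.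
  by move=> dT T P X1 X2 rX1 rX2 ind eps _; exact: main.
move=> dT T P X1 X2 rX1 rX2 ind dep.
have [m1 [m2 [Q [psdQ h]]]] := main dT T P X1 X2 rX1 rX2 ind 0 eps00 dep.
exists m1, m2, Q; split=> // t; have := h t; rewrite mulr0 => -[h1 h2].
by split; apply/eqP; rewrite -subr_eq0; apply/eqP/cmod_eq0/le_anti;
  rewrite cmod_ge0 andbT.
Qed.
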